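(* Let $G$ be a graph (finite, undirected, loopless, multiple edges allowed) in which no quadrilateral shares an edge with a triangle or with another quadrilateral, and let $a,b:V(G)\rightarrow\mathbb{N}\setminus\{0,1\}$ be two functions. If $d_G(x)\ge a(x)+b(x)+2\mu_G(x)-3$ for each $x\in V(G)$, then $G$ admits an $(a,b)$-feasible partition, that is, there is a partition $(X,Y)$ of $V(G)$ into two disjoint nonempty sets such that $d_X(x)\geq a(x)$ for each $x\in X$ and $d_Y(y)\geq b(y)$ for each $y\in Y$.
   Context: All graphs are finite and undirected, have a nonempty vertex set, and may have multiple edges but no loops. $\mathbb{N}$ denotes the set of nonnegative integers. For $X\subseteq V(G)$ and $v\in V(G)$, $d_X(v)$ is the number of edges (counted with multiplicity) between $v$ and $X\setminus\{v\}$; $d_G(v)=d_{V(G)}(v)$. For distinct vertices $u,v$, $\mu_G(u,v)$ is the number of edges joining $u$ and $v$ in $G$, and $\mu_G(v)=\max\{\mu_G(u,v):u\in V(G)\setminus\{v\}\}$ (taken to be $0$ if $v$ is the only vertex). A partition $(X,Y)$ of $V(G)$ means two disjoint nonempty sets $X,Y$ with $X\cup Y=V(G)$. It is $(a,b)$-feasible if $d_X(x)\geq a(x)$ for each $x\in X$ and $d_Y(y)\geq b(y)$ for each $y\in Y$. A triangle is a cycle of length 3 and a quadrilateral is a cycle of length 4. The condition that no quadrilateral shares an edge with a triangle or with another quadrilateral is understood as: $G$ contains none of the graphs $K_4^-$, $C_5^+$, $K_{2,3}$, $L_3$ as a (not necessarily induced) subgraph. Here $K_4^-$ is $K_4$ with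 one edge removed, $C_5^+$ is the 5-cycle $C_5$ with one edge added between two nonadjacent vertices, $K_{2,3}$ is the complete bipartite graph with parts of sizes 2 and 3, and $L_3$ is the graph consisting of two quadrilaterals sharing exactly one common edge (so it has 6 vertices and 7 edges). In particular, 4-cycles that differ only by the choice of parallel edges are not regarded as different quadrilaterals. *)

(* Defs.v *)
From mathcomp Require Import all_boot.

Set Implicit Arguments.
Unset Strict Implicit.
Unset Printing Implicit Defensive.

(* Edges are recorded only through their multiplicities: [mult u v] is the
   number of edges joining u and v. *)
Record multigraph := Multigraph {
  vertex :> finType;
  mult : vertex -> vertex -> nat;
  mult_sym : forall u v, mult u v = mult v u;
  mult_loopless : forall v, mult v v = 0;
  vertex_nonempty : 0 < #|vertex| }.

Section MultigraphTheory.
Variable G : multigraph.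
Implicit Types (X Y : {set G}) (v : G) (a b : G -> nat).

Definition deg_in X v : nat := \sum_(u in X :\ v) mult v u.

Definition deg v : nat := deg_in [set: G] v.

(* The maximum over an empty range is 0. *)
Definition max_mult v : nat := \max_(u : G | u != v) mult u v.

Definition is_bipartition X Y : Prop :=
  [/\ X != set0, Y != set0, [disjoint X & Y] & X :|: Y = [set: G]].

Definition feasible a b X Y : Prop :=
  (forall x, x \in X -> a x <= deg_in X x) /\
  (forall y, y \in Y -> b y <= deg_in Y y).

End MultigraphTheory.

(* H is isomorphic to a (not necessarily induced) subgraph of G. *)
Definition has_subgraph (G H : multigraph) : Prop :=
  exists f : H -> G,
    injective f /\ forall u v : H, mult u v <= mult (f u) (f v).

Section SimpleGraph.
Variables (n : nat) (E : seq (nat * nat)).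

Definition simple_mult (i j : 'I_n.+1) : nat :=
  (i != j) && (((val i, val j) \in E) || ((val j, val i) \in E)).

Lemma simple_mult_sym i j : simple_mult i j = simple_mult j i.
Proof. by rewrite /simple_mult eq_sym orbC. Qed.

Lemma simple_mult_loopless i : simple_mult i i = 0.
Proof. by rewrite /simple_mult eqxx. Qed.

Lemma simple_nonempty : 0 < #|'I_n.+1|.
Proof. by rewrite card_ord. Qed.

(* The simple graph on {0, ..., n} (so n + 1 vertices) with edge list E, each
   edge being listed in one orientation. *)
Definition simple_graph : multigraph :=
  Multigraph simple_mult_sym simple_mult_loopless simple_nonempty.

End SimpleGraph.

(* K_4 without the edge {2, 3}. *)
Definition K4_minus : multigraph :=
  simple_graph 3 [:: (0, 1); (0, 2); (0, 3); (1, 2); (1, 3)].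

(* The cycle 0 1 2 3 4 with the chord {0, 2}. *)
Definition C5_plus : multigraph :=
  simple_graph 4 [:: (0, 1); (1, 2); (2, 3); (3, 4); (4, 0); (0, 2)].

(* Parts {0, 1} and {2, 3, 4}. *)
Definition K23 : multigraph :=
  simple_graph 4 [:: (0, 2); (0, 3); (0, 4); (1, 2); (1, 3); (1, 4)].

(* The quadrilaterals 0 1 2 3 and 0 1 4 5, sharing the edge {0, 1}. *)
Definition L3 : multigraph :=
  simple_graph 5
    [:: (0, 1); (1, 2); (2, 3); (3, 0); (1, 4); (4, 5); (5, 0)].

(* No quadrilateral shares an edge with a triangle or with another
   quadrilateral, where quadrilaterals differing only by the choice of parallel
   edges are not distinguished. *)
Definition quadrilaterals_isolated (G : multigraph) : Prop :=
  [/\ ~ has_subgraph G K4_minus, ~ has_subgraph G C5_plus,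
      ~ has_subgraph G K23 & ~ has_subgraph G L3].

(* Main.v *)
Require Import Defs.
From mathcomp Require Import all_boot zify.

Set Implicit Arguments.
Unset Strict Implicit.
Unset Printing Implicit Defensive.

(** Raising [a] if necessary, every vertex [x] has degree exactly
    [a x + b x + 2 * max_mult x - 3]. Call a set meager for a threshold if no
    nonempty subset of it reaches the threshold at all of its vertices. Two
    disjoint sets that are not meager, for [a] and for [b], contain a feasible
    pair, and a feasible pair grows to a feasible partition because all degrees
    are at least [a x + b x - 1] ([feasible_pair_extend]). So suppose that of two
    disjoint sets one is always meager; this is to be refuted.

    A state is a splitting of the vertices into two meager sides P (for [a]) and
    Q (for [b]) and one further vertex, the centre [v]. States exist: take a
    vertex out of a smallest set that is not meager ([initial_state]). Let
    e(P) + e(Q) - (sum of a - 1 over P) - (sum of b - 1 over Q) be maximal. A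
    vertex is low if its degree in its own side is below its threshold; a nonempty
    side has low vertices. Exchanging the centre with a low vertex, or moving a
    low vertex to the other side, cannot increase the potential, and one of two
    disjoint sets is meager. Together these facts show ([low_cases]) that a low
    vertex [z] of a side in which [v] reaches its threshold is a neighbour of
    [v] and either joined to it by enough parallel edges to make up for the excess
    of [v], or loose: it has no parallel edges and misses its threshold by one on
    both sides. Exchanging [z] with [v]
    in the extremal instances of the first case, and moving [z] across in the
    second, leads to further optimal states, to which the same applies.

    Two situations are contradictory.

    - Suppose that the low vertices of a side can be moved across freely, and that
      this only makes neighbours of [v] low ([pool_false]). An edge lies in at most
      one triangle and no triangle shares an edge with a quadrilateral. So the
      vertices that become low after the first ones have gone form triangles with
      them and [v], and the vertices that become low next cannot be neighbours of
      [v].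

    - Suppose that low vertices [z] of one side and [y] of the other form a
      triangle with [v], and that there is another low vertex [p] ([triangle_false]).
      The exchanges rotate the triangle, and each of its vertices turns out to have
      a pendant neighbour of the kind of [p]. In each of the states so obtained the
      low vertices are known, so a vertex that is low in the remainder of a side
      must be adjacent to all three pendants. Both sides provide such a vertex,
      which gives a [K23].

    If an optimal state has a centre with a multiple edge, then in both sides the
    low vertices are neighbours of [v], and one of the two situations occurs
    ([optimal_center_simple]). If all centres are simple, then [v] may be just
    below its threshold on one side; it can then join that side, and in the
    bipartitions of all vertices that arise each low vertex of one side is adjacent
    to each low vertex of the other ([total_complete]). This excludes low vertices that are not adjacent to
    [v] as soon as the other side has two low vertices ([light_adj_center]), and
    again one of the two situations occurs ([no_optimal_state]). *)

Ltac clia := clear; lia.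

(** * Degrees and adjacency in multigraphs *)

Section Degrees.
Variable G : multigraph.
Implicit Types (X Y : {set G}) (u v w x y : G).

Definition adj x y := 0 < mult x y.

Lemma adjC x y : adj x y = adj y x.
Proof. by rewrite /adj mult_sym. Qed.

Lemma adj_irr x : adj x x = false.
Proof. by rewrite /adj mult_loopless. Qed.

Lemma adj_neq x y : adj x y -> x != y.
Proof. by apply: contraTneq => ->; rewrite adj_irr. Qed.

Lemma mult_nadj x y : ~~ adj x y -> mult x y = 0.
Proof. by rewrite /adj; lia. Qed.

Lemma mult_le_max x y : mult x y <= max_mult y.
Proof.
have [->|xy] := eqVneq x y; first by rewrite mult_loopless.
exact: (@leq_bigmax_cond _ (fun u => u != y) (fun u => mult u y)).
Qed.

Lemma deg_inE X v : deg_in X v = \sum_(u in X) mult v u.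
Proof.
rewrite /deg_in; have [vX|vX] := boolP (v \in X).
  by rewrite (big_setD1 v vX) /= mult_loopless.
by apply: eq_bigl => u; rewrite !inE; case: eqVneq => // ->; rewrite (negPf vX).
Qed.

Lemma deg_in_rem X x v : x \in X -> deg_in X v = mult v x + deg_in (X :\ x) v.
Proof. by move=> xX; rewrite !deg_inE (big_setD1 x xX). Qed.

Lemma deg_in_add X x v : x \notin X -> deg_in (x |: X) v = mult v x + deg_in X v.
Proof. by move=> xX; rewrite !deg_inE big_setU1. Qed.

Lemma deg_in_split X Y v :
  Y \subset X -> deg_in X v = deg_in (X :\: Y) v + deg_in Y v.
Proof.
move=> YX; rewrite !deg_inE (big_setID Y) /= addnC; congr (_ + _).
by apply: eq_bigl => u; rewrite inE andb_idl // => /(subsetP YX).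
Qed.

Lemma deg_in_sub X Y v : X \subset Y -> deg_in X v <= deg_in Y v.
Proof. by move=> XY; rewrite (deg_in_split _ XY) leq_addl. Qed.

Lemma deg_in_gt0 X v : 0 < deg_in X v -> exists2 u, u \in X & adj v u.
Proof.
rewrite deg_inE lt0n sum_nat_eq0 negb_forall_in => /exists_inP[u uX nz].
by exists u; rewrite // /adj lt0n.
Qed.

Lemma deg_in_le1 X u v :
  {in X, forall x, adj v x -> x = u} -> deg_in X v <= mult v u.
Proof.
move=> h; have [uX|uX] := boolP (u \in X).
  rewrite (deg_in_rem _ uX) deg_inE big1 ?addn0 // => x.
  rewrite !inE => /andP[xu xX]; apply: mult_nadj.
  by apply: contra_neqN xu => /(h x xX).
rewrite deg_inE big1 // => x xX; apply: mult_nadj.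
by apply: contraNN uX => /(h x xX) <-.
Qed.

Lemma deg_setT v X Y x : [disjoint X & Y] -> x \notin X :|: Y ->
  [set: G] = x |: (X :|: Y) -> deg v = mult v x + (deg_in X v + deg_in Y v).
Proof.
move=> dXY xXY e; rewrite /deg e deg_in_add // (@deg_in_split _ Y) ?subsetUr //.
by rewrite setDUl setDv setU0 (setDidPl _).
Qed.

End Degrees.

(** * Configurations around an isolated quadrilateral *)

Section Quadrilaterals.
Variable G : multigraph.
Hypothesis hG : quadrilaterals_isolated G.
Implicit Types (p q r s u v w x y : G).

Lemma has_simple_subgraph n (E : seq (nat * nat)) (l : seq G) x0 :
  size l = n.+1 -> uniq l ->
  all (fun e => adj (nth x0 l e.1) (nth x0 l e.2)) E ->
  has_subgraph G (simple_graph n E).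
Proof.
move=> sl ul /allP hE; exists (fun i : 'I_n.+1 => nth x0 l i); split.
  by move=> i j /eqP; rewrite nth_uniq ?sl // => /eqP /val_inj.
move=> i j; rewrite /= /simple_mult; case: eqVneq => //= ij.
case: orP => // -[/hE|/hE] //=; by rewrite adjC.
Qed.

(** Two common neighbours would give a [K4_minus]. *)
Lemma edge_common_nbr u v w x : adj u v -> adj u w -> adj v w ->
  adj u x -> adj v x -> w = x.
Proof.
move=> uv uw vw ux vx; apply/eqP/negPn/negP => wx; case: hG => h _ _ _; apply: h.
apply: (@has_simple_subgraph 3 _ [:: u; v; w; x] u) => //=.
  by rewrite !inE !negb_or (adj_neq uv) (adj_neq uw) (adj_neq vw)
    (adj_neq ux) (adj_neq vx) wx.
by rewrite uv uw vw ux vx.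
Qed.

Lemma two_common_nbrs p q x y z : p != q -> x != y -> x != z -> y != z ->
  adj p x -> adj p y -> adj p z -> adj q x -> adj q y -> adj q z -> False.
Proof.
move=> pq xy xz yz px py pz qx qy qz; case: hG => _ _ h _; apply: h.
apply: (@has_simple_subgraph 4 _ [:: p; q; x; y; z] p) => //=.
  by rewrite !inE !negb_or (adj_neq px) (adj_neq py) (adj_neq pz)
    (adj_neq qx) (adj_neq qy) (adj_neq qz) pq xy xz yz.
by rewrite px py pz qx qy qz.
Qed.

(** If [e] is one of [r] and [s], then two triangles share an edge; otherwise
    [p e q r s] is a pentagon with the chord [p q]. *)
Lemma quad_no_triangle p q r s e : adj p q -> adj q r -> adj r s -> adj s p ->
  p != r -> q != s -> adj e p -> adj e q -> False.
Proof.
move=> pq qr rs sp pr qs ep eq.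
have [er|er] := eqVneq e r.
  subst e; move: qs; rewrite (@edge_common_nbr p r q s) ?eqxx //;
  by rewrite // adjC.
have [es|es] := eqVneq e s.
  subst e; move: pr; rewrite (@edge_common_nbr q s p r) ?eqxx //; by rewrite // adjC.
case: hG => _ h _ _; apply: h.
apply: (@has_simple_subgraph 4 _ [:: p; e; q; r; s] p) => //=.
  rewrite !inE !negb_or (adj_neq pq) (adj_neq qr) (adj_neq rs)
    (adj_neq eq) pr qs er es [p == e]eq_sym (adj_neq ep) /=.
  by rewrite eq_sym (adj_neq sp).
by rewrite [adj p e]adjC ep eq qr rs sp pq.
Qed.

Lemma quads_no_common_edge p q r s u w : uniq [:: p; q; r; s; u; w] ->
  adj p q -> adj q r -> adj r s -> adj s p ->
  adj q u -> adj u w -> adj w p -> False.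
Proof.
move=> un pq qr rs sp qu uw wp; case: hG => _ _ _ h; apply: h.
apply: (@has_simple_subgraph 5 _ [:: p; q; r; s; u; w] p) => //=.
by rewrite pq qr rs sp qu uw wp.
Qed.

End Quadrilaterals.
(** * Meager sets *)

Lemma Some_neq (s r : bool) : s != r -> (Some s == Some r) = false.
Proof. by move=> /negPf sr; rewrite (inj_eq Some_inj). Qed.

Section Meager.
Variables (G : multigraph) (t : bool -> G -> nat).
Implicit Types (X Y : {set G}) (v x y : G) (s r : bool).

(** [t s] is the degree threshold of side [s]. A set is meager when it contains
    no nonempty set that is feasible for that side. *)
Definition meager s X :=
  [forall Y : {set G}, (Y \subset X) && (Y != set0) ==>
     [exists x in Y, deg_in Y x < t s x]].

Lemma meager_low s X : meager s X -> X != set0 ->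
  exists2 x, x \in X & deg_in X x < t s x.
Proof.
by move=> /forallP/(_ X); rewrite subxx /= => /implyP h /h /exists_inP[x]; exists x.
Qed.

Lemma meager_sub s X Y : Y \subset X -> meager s X -> meager s Y.
Proof.
move=> YX /forallP h; apply/forallP => Z; apply/implyP => /andP[ZY Z0].
by have /implyP := h Z; rewrite (subset_trans ZY YX) Z0 => /(_ isT).
Qed.

(** A subset containing [x] has [x] itself as a vertex below the threshold. *)
Lemma meager_add s X x : meager s X -> deg_in X x < t s x -> meager s (x |: X).
Proof.
move=> mX xl; apply/forallP => Y; apply/implyP => /andP[YX Y0].
have [xY|xY] := boolP (x \in Y).
  apply/exists_inP; exists x => //; apply: leq_ltn_trans xl.
  rewrite (deg_in_rem _ xY) mult_loopless add0n; apply: deg_in_sub.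
  by rewrite subDset.
apply/exists_inP; apply: meager_low Y0; apply: meager_sub mX.
apply/subsetP => y yY; have := subsetP YX y yY; rewrite !inE.
by case: eqVneq => // e; rewrite -e yY in xY.
Qed.

Lemma not_meager s X : ~~ meager s X ->
  exists Y : {set G}, [/\ Y \subset X, Y != set0 &
    forall x, x \in Y -> t s x <= deg_in Y x].
Proof.
rewrite negb_forall => /existsP[Y]; rewrite negb_imply => /andP[/andP[YX Y0] h].
exists Y; split=> // x xY; rewrite leqNgt; apply: contraNN h => xl.
by apply/exists_inP; exists x.
Qed.

(** Up to an additive constant, twice the number of edges inside [X] minus
    twice the sum of [t s x - 1] over [X]; charging the vertices outside [X]
    keeps the value in [nat]. *)
Definition side_potential s X :=
  \sum_(x in X) deg_in X x + \sum_(x in ~: X) 2 * (t s x - 1).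

Lemma side_potential_add s X x : x \notin X ->
  side_potential s (x |: X) + 2 * (t s x - 1) = side_potential s X + 2 * deg_in X x.
Proof.
move=> xX; rewrite /side_potential big_setU1 //=.
have -> : \sum_(i in X) deg_in (x |: X) i =
          \sum_(i in X) deg_in X i + deg_in X x.
  rewrite [deg_in X x]deg_inE -big_split /=; apply: eq_bigr => i _.
  by rewrite deg_in_add // addnC mult_sym.
rewrite deg_in_add // mult_loopless.
have xC : x \in ~: X by rewrite inE.
rewrite [in RHS](big_setD1 x xC) /=.
have -> : ~: (x |: X) = ~: X :\ x by rewrite setCU setIC setDE.
by lia.
Qed.

(** * States *)

(** [Some s] places a vertex in side [s], [None] leaves it undecided. *)
Definition state := {ffun G -> option bool}.
Implicit Types c : state.

Definition side c s := [set x | c x == Some s].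

Definition upd c x o : state := [ffun y => if y == x then o else c y].

Definition sdeg c s x := deg_in (side c s) x.

Lemma in_side c s x : (x \in side c s) = (c x == Some s).
Proof. by rewrite inE. Qed.

Lemma updE c x o y : upd c x o y = if y == x then o else c y.
Proof. by rewrite ffunE. Qed.

Lemma upd_eq c x o : upd c x o x = o.
Proof. by rewrite updE eqxx. Qed.

Lemma upd_neq c x o y : y != x -> upd c x o y = c y.
Proof. by rewrite updE => /negPf ->. Qed.

Lemma upd_upd c x o o' : upd (upd c x o) x o' = upd c x o'.
Proof. by apply/ffunP => y; rewrite !updE; case: eqVneq. Qed.

Lemma upd_id c x o : c x = o -> upd c x o = c.
Proof. by move=> e; apply/ffunP => y; rewrite !updE; case: eqVneq => [->|]. Qed.

Lemma side_in c x s : side (upd c x (Some s)) s = x |: side c s.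
Proof. by apply/setP => y; rewrite !inE updE; case: (y == x); rewrite ?eqxx. Qed.

Lemma side_out c x o s : o != Some s -> side (upd c x o) s = side c s :\ x.
Proof.
by move=> oN; apply/setP => y; rewrite !inE updE; case: (y == x) => /=; [apply: negPf|].
Qed.

Lemma sdeg_upd c x o s v :
  sdeg (upd c x o) s v + (c x == Some s) * mult v x
  = sdeg c s v + (o == Some s) * mult v x.
Proof.
rewrite /sdeg; have [cx|cx] := boolP (c x == Some s); have [-> | oN] := eqVneq o (Some s).
- by rewrite side_in (setUidPr _) // sub1set in_side.
- by rewrite side_out // (@deg_in_rem _ (side c s) x) ?in_side //; lia.
- by rewrite side_in deg_in_add ?in_side //; lia.
rewrite side_out // (_ : side c s :\ x = side c s); first by lia.
by apply/setDidPl; rewrite disjoint_sym disjoints1 in_side.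
Qed.

Lemma sdeg_push c x s y :
  c x = None -> sdeg (upd c x (Some s)) s y = sdeg c s y + mult y x.
Proof. by move=> cx; have := sdeg_upd c x (Some s) s y; rewrite cx eqxx /=; lia. Qed.

Lemma sdeg_push_other c x s r y : s != r ->
  c x = None -> sdeg (upd c x (Some s)) r y = sdeg c r y.
Proof.
move=> sr cx; have := sdeg_upd c x (Some s) r y.
by rewrite cx (inj_eq Some_inj) (negPf sr) /=; lia.
Qed.

Lemma sdeg_pull c x s y :
  c x = Some s -> sdeg (upd c x None) s y + mult y x = sdeg c s y.
Proof. by move=> cx; have := sdeg_upd c x None s y; rewrite cx eqxx /=; lia. Qed.

Lemma sdeg_pull_other c x s r y : s != r ->
  c x = Some s -> sdeg (upd c x None) r y = sdeg c r y.
Proof.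
move=> sr cx; have := sdeg_upd c x None r y.
by rewrite cx (inj_eq Some_inj) (negPf sr) /=; lia.
Qed.

(** The centre [v] enters side [s], and [z] becomes the centre. *)
Definition amove c v s z := upd (upd c v (Some s)) z None.

Definition low c s x := (c x == Some s) && (sdeg c s x < t s x).

Lemma low_side c s x : low c s x -> c x = Some s.
Proof. by case/andP => /eqP. Qed.

Lemma low_lt c s x : low c s x -> sdeg c s x < t s x.
Proof. by case/andP. Qed.

Lemma lowE c s x : c x = Some s -> low c s x = (sdeg c s x < t s x).
Proof. by rewrite /low => ->; rewrite eqxx. Qed.

Definition good c := forall s, meager s (side c s).

Lemma good_pull c x : good c -> good (upd c x None).
Proof.
by move=> gc s; apply: meager_sub (gc s); rewrite side_out // subD1set.
Qed.

Lemma good_push c x s : good c -> c x = None -> sdeg c s x < t s x ->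
  good (upd c x (Some s)).
Proof.
move=> gc cx xl r; have [->|rs] := eqVneq r s.
  by rewrite side_in; apply: meager_add.
rewrite side_out; first by apply: meager_sub (gc r); apply: subD1set.
by rewrite (inj_eq Some_inj) eq_sym.
Qed.

Lemma good_low c s x : good c -> c x = Some s -> exists y, low c s y.
Proof.
move=> gc cx; have [|y] := meager_low (gc s).
  by apply/set0Pn; exists x; rewrite in_side cx.
by rewrite in_side => cy yl; exists y; rewrite /low cy.
Qed.

Lemma sdeg_gt0 c s x : 0 < sdeg c s x -> exists2 y, c y = Some s & adj x y.
Proof. by case/deg_in_gt0 => y; rewrite in_side => /eqP cy xy; exists y. Qed.

Definition potential c :=
  side_potential true (side c true) + side_potential false (side c false).

Lemma potential_push c x s : c x = None ->
  potential (upd c x (Some s)) + 2 * (t s x - 1) = potential c + 2 * sdeg c s x.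
Proof.
move=> cx; have xN r : x \notin side c r by rewrite in_side cx.
have other r : r != s -> side (upd c x (Some s)) r = side c r.
  move=> rs; rewrite side_out ?(inj_eq Some_inj) 1?eq_sym //.
  by apply/setDidPl; rewrite disjoint_sym disjoints1.
have := side_potential_add s (xN s); rewrite /potential /sdeg -side_in.
by case: s xN other => xN other; [rewrite (other false) | rewrite (other true)]; lia.
Qed.

Lemma potential_pull c x s : c x = Some s ->
  potential c + 2 * (t s x - 1) = potential (upd c x None) + 2 * sdeg c s x.
Proof.
move=> cx; have := @potential_push (upd c x None) x s.
rewrite upd_eq upd_upd upd_id // => -> //.
by rewrite -(sdeg_pull x cx) mult_loopless addn0.
Qed.

(** The undecided vertex [v] is the centre of the state. *)
Definition is_state c v := good c /\ forall x, (c x == None) = (x == v).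

Definition optimal c v :=
  is_state c v /\ forall c' v', is_state c' v' -> potential c' <= potential c.

Lemma optimal_exists c v : is_state c v -> exists c' v', optimal c' v'.
Proof.
pose P (p : state * G) := [forall s, meager s (side p.1 s)] &&
  [forall x, (p.1 x == None) == (x == p.2)].
have PP c1 v1 : reflect (is_state c1 v1) (P (c1, v1)).
  apply: (iffP andP) => /= -[/forallP h1 h2]; split=> //.
    by move=> x; have /forallP/(_ x)/eqP := h2.
  by apply/forallP => x; rewrite h2.
move=> /PP h; case: (arg_maxnP (fun p => potential p.1) h) => -[c1 v1] /PP h1 hm.
by exists c1, v1; split=> // c2 v2 /PP /hm.
Qed.

End Meager.

Ltac symm := solve [done | by rewrite adjC | by rewrite eq_sym].

Section Moves.
Variables (G : multigraph).
Implicit Types (v x y z : G) (s r : bool) (c : state G).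

Lemma val_neq (c : state G) x y a b : c x = a -> c y = b -> a != b -> x != y.
Proof. by move=> <- <-; apply: contraNneq => ->. Qed.

Lemma sdeg_shift c s r z x : s != r -> c z = Some s ->
  sdeg (upd c z (Some r)) s x + mult x z = sdeg c s x.
Proof.
move=> sr cz; have := sdeg_upd c z (Some r) s x.
by rewrite cz eqxx Some_neq 1?eq_sym // mul1n mul0n addn0.
Qed.

Lemma sdeg_shift_other c s r z x : s != r -> c z = Some s ->
  sdeg (upd c z (Some r)) r x = sdeg c r x + mult x z.
Proof.
move=> sr cz; have := sdeg_upd c z (Some r) r x.
by rewrite cz eqxx Some_neq // mul1n mul0n addn0.
Qed.

Lemma sdeg_amove c v s z x : c v = None -> c z = Some s ->
  sdeg (amove c v s z) s x + mult x z = sdeg c s x + mult x v.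
Proof.
move=> cv cz; have zv : z != v by apply: val_neq cz cv _.
by rewrite -(sdeg_push s x cv) -(@sdeg_pull _ (upd c v (Some s)) z) ?upd_neq.
Qed.

Lemma sdeg_amove_other c v s r z x : s != r -> c v = None -> c z = Some s ->
  sdeg (amove c v s z) r x = sdeg c r x.
Proof.
move=> sr cv cz; have zv : z != v by apply: val_neq cz cv _.
by rewrite -(sdeg_push_other x sr cv) /amove (sdeg_pull_other x sr) ?upd_neq.
Qed.

Lemma amove_v c v s z : v != z -> amove c v s z v = Some s.
Proof. by move=> vz; rewrite /amove upd_neq // upd_eq. Qed.

Lemma amove_z c v s z : amove c v s z z = None.
Proof. exact: upd_eq. Qed.

Lemma amove_neq c v s z x : x != v -> x != z -> amove c v s z x = c x.
Proof. by move=> xv xz; rewrite /amove !upd_neq. Qed.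

End Moves.

(** * Triangles with pendants *)

Section Triangles.
Variables (G : multigraph) (t : bool -> G -> nat).
Hypothesis hG : quadrilaterals_isolated G.
Hypothesis t_ge2 : forall s x, 2 <= t s x.
Implicit Types (v x y z p u w : G) (s r : bool) (c : state G).

(** [h c s r v z y p] stands for a state [c] with centre [v], in which [z] and
    [p] are low vertices of side [s], and the triangle [v z y] has its third
    vertex [y] low in side [r]. The hypotheses ask for its closure under moving
    [p] across and under rotating the triangle. It is abstract because triangles
    whose centre has a multiple edge and triangles with a simple centre are closed
    under these moves for different reasons. *)
Variable h : state G -> bool -> bool -> G -> G -> G -> G -> Prop.
Hypothesis h_good : forall c s r v z y p, h c s r v z y p -> good t c.
Hypothesis h_sides : forall c s r v z y p, h c s r v z y p ->
  [/\ s != r, c v = None, c z = Some s, c p = Some s & c y = Some r].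
Hypothesis h_adj : forall c s r v z y p, h c s r v z y p ->
  [/\ adj v z, adj z y, adj y v, adj v p & p != z].
Hypothesis h_simple : forall c s r v z y p, h c s r v z y p -> max_mult p = 1.
Hypothesis h_only : forall c s r v z y p x, h c s r v z y p ->
  low t (upd c p None) s x -> x = z.
Hypothesis h_shift : forall c s r v z y p, h c s r v z y p ->
  h (upd c p (Some r)) r s v y z p.
Hypothesis h_pendant : forall c s r v z y p, h c s r v z y p ->
  exists w, adj w z /\ low t (upd c z None) s w.
Hypothesis h_amove : forall c s r v z y p w, h c s r v z y p ->
  adj w z -> low t (upd c z None) s w -> h (amove c v s z) s r z v y w.

Lemma lowU c y o s x : x != y -> c x = Some s ->
  low t (upd c y o) s x = (sdeg (upd c y o) s x < t s x).
Proof. by move=> xy cx; rewrite lowE ?upd_neq. Qed.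

(** Otherwise [a b y x] is a quadrilateral on the edge [a b] of the triangle. *)
Lemma triangle_quad a b e x y : adj a b -> adj b e -> adj e a ->
  adj a x -> x != b -> adj b y -> y != a -> adj x y -> False.
Proof.
move=> ab be ea ax xb bY ya xy.
by apply: (@quad_no_triangle _ hG a b y x e); symm.
Qed.

(** [p], [w] and [u] are the pendants of the triangle vertices [v], [z] and [y].
    The vertex [x] found here is low in side [s] without [z], [p] and [w]. The
    three rotations of the triangle give states in which side [s] consists of
    this remainder, one vertex of the triangle and its pendant, and in which
    only the triangle vertex is low once the pendant has left. So [x] is adjacent
    to each triangle vertex or to its pendant, and the isolation of
    quadrilaterals leaves only the pendants. *)
Lemma pendant_core c s r v z y p w u : h c s r v z y p ->
  adj w z -> low t (upd c z None) s w ->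
  adj u y -> low t (upd c y None) r u ->
  exists2 x, c x = Some s & [/\ adj x w, adj x p & adj x u].
Proof.
move=> H wz wl uy ul.
have [sr cv cz cp cy] := h_sides H; have [vz zy yv vp pz] := h_adj H.
have rs : r != s by rewrite eq_sym.
have cw : c w = Some s.
  by have := low_side wl; rewrite updE; case: (w == z).
have cu : c u = Some r.
  by have := low_side ul; rewrite updE; case: (u == y).
have wv : w != v by apply: val_neq cw cv _.
have uv : u != v by apply: val_neq cu cv _.
have pv : p != v by apply: val_neq cp cv _.
have yz : y != z by rewrite (val_neq cy cz) ?Some_neq.
have nwz := adj_neq wz; have nuy := adj_neq uy.
have nuw : u != w by rewrite (val_neq cu cw) ?Some_neq.
have nup : u != p by rewrite (val_neq cu cp) ?Some_neq.
have nyp : y != p by rewrite (val_neq cy cp) ?Some_neq.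
have nyw : y != w by rewrite (val_neq cy cw) ?Some_neq.
have nzu : z != u by rewrite (val_neq cz cu) ?Some_neq.
have nadj_pz : ~~ adj p z.
  apply/negP => pz'; move: nyp; rewrite (@edge_common_nbr _ hG v z y p) ?eqxx //; symm.
have nwp : w != p by apply: contraNneq nadj_pz => <-.
have nadj_wp : ~~ adj w p.
  apply/negP => wp; apply: (@triangle_quad v z y p w); symm.
have nadj_up : ~~ adj u p.
  apply/negP => up; apply: (@triangle_quad v y z p u); symm.
have nadj_uw : ~~ adj u w.
  apply/negP => uw; apply: (@triangle_quad z y v w u); symm.
(* [H], [H1] and [H5] are the states whose side [s] contains [z w], [v p] and
   [y u] respectively, besides the remainder. *)
have H1 := h_amove H wz wl.
have H2 := h_shift H; set c2 := upd c p (Some r) in H2.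
have c2v : c2 v = None by rewrite upd_neq 1?eq_sym.
have c2y : c2 y = Some r by rewrite upd_neq.
have c2u : c2 u = Some r by rewrite upd_neq.
have c2z : c2 z = Some s by rewrite upd_neq 1?eq_sym.
have c2w : c2 w = Some s by rewrite upd_neq.
have ul2 : low t (upd c2 y None) r u.
  rewrite lowU //; apply: leq_ltn_trans (low_lt ul).
  have := sdeg_pull u cy; have := sdeg_pull u c2y.
  by rewrite (sdeg_shift_other u sr cp) (mult_nadj nadj_up); clia.
have H3 := h_amove H2 uy ul2.
have H4 := h_shift H3; set c3 := amove c2 v r y in H3 H4.
set c4 := upd c3 u (Some s) in H4.
have c3u : c3 u = Some r by rewrite amove_neq.
have c3w : c3 w = Some s by rewrite amove_neq // eq_sym.
have c3z : c3 z = Some s by rewrite amove_neq // 1?eq_sym ?(adj_neq vz).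
have c3y : c3 y = None by apply: amove_z.
have c4z : c4 z = Some s by rewrite upd_neq.
have c4w : c4 w = Some s by rewrite upd_neq // eq_sym.
have c4y : c4 y = None by rewrite upd_neq // eq_sym.
have d4 x : sdeg c4 s x + mult x p = sdeg c s x + mult x u.
  rewrite (sdeg_shift_other x rs c3u) (sdeg_amove_other x rs c2v c2y).
  by have := sdeg_shift x sr cp; rewrite -/c2; clia.
have wl4 : low t (upd c4 z None) s w.
  rewrite lowU //; apply: leq_ltn_trans (low_lt wl).
  have := sdeg_pull w c4z; have := d4 w; have := sdeg_pull w cz.
  by rewrite [mult w u]mult_sym (mult_nadj nadj_uw); clia.
have H5 := h_amove H4 wz wl4.
(* The remainder of side [s], which is not empty since [w] is not low in [c]. *)
pose cR := upd (upd (upd c z None) p None) w None.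
have dR x : sdeg cR s x + mult x w + mult x p + mult x z = sdeg c s x.
  have := sdeg_pull x cz; have := @sdeg_pull _ (upd c z None) p s x.
  rewrite upd_neq // => /(_ cp); have := @sdeg_pull _ (upd (upd c z None) p None) w s x.
  by rewrite !upd_neq // -/cR => /(_ cw); clia.
have gR : good t cR by do 3! apply: good_pull; apply: h_good H.
have w_high : t s w <= sdeg c s w.
  rewrite leqNgt; apply/negP => wlt; move: nwz.
  rewrite (h_only H (_ : low t (upd c p None) s w)) ?eqxx // lowU //.
  by move: wlt (sdeg_pull w cp); clia.
have [x0 cx0 _] : exists2 x, cR x = Some s & adj w x.
  apply: sdeg_gt0; have := dR w; rewrite mult_loopless (mult_nadj nadj_wp).
  have := mult_le_max z w; rewrite mult_sym (h_simple H1).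
  by move: (t_ge2 s w) w_high; clia.
have [x xl] := good_low gR cx0; have := low_side xl; have xlt := low_lt xl.
rewrite /cR !updE; case: eqP => // /eqP xw; case: eqP => // /eqP xp.
case: eqP => // /eqP xz cx; exists x => //.
have xv : x != v by apply: val_neq cx cv _.
have xy : x != y by rewrite (val_neq cx cy) ?Some_neq.
have xu : x != u by rewrite (val_neq cx cu) ?Some_neq.
have a1 : adj x w || adj x z.
  apply/negPn/negP; rewrite negb_or => /andP[/mult_nadj e1 /mult_nadj e2].
  move: (xz); rewrite (@h_only _ _ _ _ _ _ _ x H) ?eqxx //.
  by rewrite lowU //; move: xlt e1 e2 (dR x) (sdeg_pull x cp); clia.
have a2 : adj x p || adj x v.
  apply/negPn/negP; rewrite negb_or => /andP[/mult_nadj e1 /mult_nadj e2].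
  move: (xv); rewrite (@h_only _ _ _ _ _ _ _ x H1) ?eqxx //.
  have c1x : amove c v s z x = Some s by rewrite amove_neq.
  have c1w : amove c v s z w = Some s by rewrite amove_neq.
  by rewrite lowU //; move: xlt e1 e2 (dR x) (sdeg_amove x cv cz) (sdeg_pull x c1w); clia.
have a3 : adj x u || adj x y.
  apply/negPn/negP; rewrite negb_or => /andP[/mult_nadj e1 /mult_nadj e2].
  move: (xy); rewrite (@h_only _ _ _ _ _ _ _ x H5) ?eqxx //.
  have c4x : c4 x = Some s by rewrite upd_neq // amove_neq // upd_neq.
  have c5w : amove c4 y s z w = Some s by rewrite amove_neq // eq_sym.
  have c5x : amove c4 y s z x = Some s by rewrite amove_neq.
  rewrite lowU //; move: xlt e1 e2 (dR x) (d4 x) (sdeg_amove x c4y c4z) (sdeg_pull x c5w).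
  by clia.
have xw' : adj x w.
  case/orP: a1 => // xz'; exfalso; case/orP: a2 => [xp'|xv'].
    by apply: (@triangle_quad v z y p x); symm.
  move: xy; rewrite (@edge_common_nbr _ hG v z x y) ?eqxx //; symm.
split=> //.
  case/orP: a2 => // xv'; exfalso.
  by apply: (@triangle_quad z v y w x); symm.
case/orP: a3 => // xy'; exfalso.
by apply: (@triangle_quad z y v w x); symm.
Qed.

Lemma triangle_false c s r v z y p : h c s r v z y p -> False.
Proof.
move=> H; have [sr cv cz cp cy] := h_sides H; have [vz zy yv vp pz] := h_adj H.
have rs : r != s by rewrite eq_sym.
have H2 := h_shift H; set c2 := upd c p (Some r) in H2.
have [w [wz wl]] := h_pendant H; have [u [uy ul2]] := h_pendant H2.
have cw : c w = Some s.
  by have := low_side wl; rewrite updE; case: (w == z).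
have nyp : y != p by rewrite (val_neq cy cp) ?Some_neq.
have nadj_pz : ~~ adj p z.
  apply/negP => pz'; move: nyp; rewrite (@edge_common_nbr _ hG v z y p) ?eqxx //; symm.
have nadj_py : ~~ adj p y.
  apply/negP => py'; move: pz; rewrite (@edge_common_nbr _ hG v y p z) ?eqxx //; symm.
have nwp : w != p by apply: contraNneq nadj_pz => <-.
have nup : u != p by apply: contraNneq nadj_py => <-.
have c2y : c2 y = Some r by rewrite upd_neq.
have c2z : c2 z = Some s by rewrite upd_neq 1?eq_sym.
have cu : c u = Some r.
  have := low_side ul2; rewrite updE; case: (u == y) => //.
  by rewrite upd_neq.
have ul : low t (upd c y None) r u.
  rewrite lowU ?(adj_neq uy) //; apply: leq_ltn_trans (low_lt ul2).
  by have := sdeg_pull u cy; have := sdeg_pull u c2y; rewrite (sdeg_shift_other u sr cp); clia.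
have c2w : c2 w = Some s by rewrite upd_neq.
have wl2 : low t (upd c2 z None) s w.
  rewrite lowU ?(adj_neq wz) //; apply: leq_ltn_trans (low_lt wl).
  by have := sdeg_pull w cz; have := sdeg_pull w c2z; have := sdeg_shift w sr cp; rewrite -/c2; clia.
have [x cx [xw xp xu]] := pendant_core H wz wl uy ul.
have [x' cx' [xu' xp' xw']] := pendant_core H2 uy ul2 wz wl2.
have c2x : c2 x = Some s by rewrite upd_neq ?(adj_neq xp).
apply: (@two_common_nbrs _ hG x x' w p u) => //.
- by rewrite (val_neq c2x cx') ?Some_neq.
- by rewrite (val_neq cw cu) ?Some_neq.
- by rewrite eq_sym.
Qed.

End Triangles.

(** * Exhausting the low neighbours of the centre *)

Section Pool.
Variables (G : multigraph) (t : bool -> G -> nat) (s : bool).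
Hypothesis hG : quadrilaterals_isolated G.
Hypothesis t_ge2 : forall s x, 2 <= t s x.
(** [X] is one side of a state with centre [v], and [z] a low vertex of the other
    side. When [y] is exchanged with [z], the degree of [v] in [X] stays the same,
    so that a second vertex [y'] can leave [X] as well. *)
Variables (X : {set G}) (v z : G).
Implicit Types (u w x y : G).
Hypothesis mX : meager t s X.
Hypothesis vX : v \notin X.
Hypothesis zX : z \notin X.
Hypothesis vz : adj v z.
Let L := [set x in X | deg_in X x < t s x].
Hypothesis X0 : X != set0.
Hypothesis L_adj : forall y, y \in L -> adj v y.
Hypothesis L_indep : forall y y', y \in L -> y' \in L -> ~~ adj y y'.
Hypothesis L_simple : forall y, y \in L -> max_mult y = 1.
Hypothesis L_deg : forall y, y \in L -> t s y <= deg_in X y + 1.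
Hypothesis leave_adj : forall y u, y \in L -> u \in X :\ y ->
  deg_in (X :\ y) u < t s u -> adj v u.
Hypothesis exchange_adj : forall y y' u, y \in L -> ~~ adj y z ->
  y' \in X :\ y -> deg_in (X :\ y) y' < t s y' -> ~~ adj y' z ->
  u \in X :\ y :\ y' -> deg_in (X :\ y :\ y') u + mult u z < t s u -> adj v u.

Let LX : L \subset X.
Proof. by apply/subsetP => x; rewrite inE => /andP[]. Qed.

Let neqX x y : x \in X -> y \notin X -> x != y.
Proof. by move=> xX; apply: contraNneq => <-. Qed.

(** A vertex [u] that becomes low when all of [L] has left owes this to a single
    neighbour in [L]. If it had two of them, [y] and [y'], then [v y u y'] would
    be a quadrilateral and [u] not a neighbour of [v]; but [u] becomes low when
    [y] is exchanged with [z] and [y'] leaves. *)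
Let partner u y : u \in X :\: L -> deg_in (X :\: L) u < t s u ->
  y \in L -> adj u y ->
  [/\ forall y', y' \in L -> adj u y' -> y' = y, deg_in (X :\ y) u < t s u
    & adj v u].
Proof.
move=> uXL ul yL uy; have /setDP[uX uL] := uXL.
have yX := subsetP LX y yL; have vy := L_adj yL.
have uv := neqX uX vX.
have uniq_y y' : y' \in L -> adj u y' -> y' = y.
  move=> y'L uy'; apply/eqP/negPn/negP => y'y.
  have y'X := subsetP LX y' y'L; have vy' := L_adj y'L.
  have nuv : ~~ adj v u.
    apply/negP => vu; move: (y'y).
    by rewrite (@edge_common_nbr _ hG v u y y') ?eqxx //; symm.
  have quad x x' : x \in L -> x' \in L -> adj u x -> adj u x' -> x != x' ->
      ~~ adj x z.
    move=> xL x'L ux ux' xx'; apply/negP => xz.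
    apply: (@quad_no_triangle _ hG v x u x' z); rewrite ?(L_adj xL) //; try symm.
    by rewrite adjC L_adj.
  have yz := quad y y' yL y'L uy uy'; have y'z := quad y' y y'L yL uy' uy.
  move: nuv; rewrite (@exchange_adj y y' u) //.
  - by apply: yz; rewrite eq_sym.
  - by rewrite !inE y'y y'X.
  - apply: leq_ltn_trans (deg_in_sub _ (subD1set X y)) _.
    by move: y'L; rewrite inE => /andP[].
  - exact: y'z.
  - by rewrite !inE (adj_neq uy') (adj_neq uy) uX.
  have nuz : ~~ adj u z.
    apply/negP => uz; apply: (@two_common_nbrs _ hG v u y y' z) => //; try symm.
    - exact: neqX.
    - exact: neqX.
  have rest : deg_in (L :\ y :\ y') u = 0.
    apply/eqP; rewrite -leqn0 leqNgt; apply/negP => /deg_in_gt0[x].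
    rewrite !inE => /and4P[xy' xy xX xl] ux.
    have xL : x \in L by rewrite inE xX xl.
    by apply: (@two_common_nbrs _ hG v u y y' x) => //; try symm; apply: L_adj.
  have y'Ly : y' \in L :\ y by rewrite !inE y'y; move: y'L; rewrite inE.
  have y'Xy : y' \in X :\ y by rewrite !inE y'y.
  move: ul (deg_in_split u LX) (deg_in_rem u yX) (deg_in_rem u y'Xy)
    (deg_in_rem u yL) (deg_in_rem u y'Ly) rest (mult_nadj nuz).
  by clia.
have le1 : deg_in L u <= mult u y by apply: deg_in_le1 => x; apply: uniq_y.
have low_y : deg_in (X :\ y) u < t s u.
  by move: ul le1 (deg_in_split u LX) (deg_in_rem u yX); clia.
by split=> //; apply: leave_adj low_y; rewrite // !inE (adj_neq uy).
Qed.

Let has_partner u : u \in X :\: L -> deg_in (X :\: L) u < t s u ->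
  exists2 y, y \in L & adj u y.
Proof.
move=> /setDP[uX uL] ul; apply: deg_in_gt0.
move: uL; rewrite inE uX /= -leqNgt.
by move: ul (deg_in_split u LX); clia.
Qed.

(** [w] becomes low when [L] and the vertices [U] that become low after [L] have
    left. It has a neighbour [u1] in [U], which forms a triangle with [v] and some
    [y1] in [L], so [w] is not adjacent to [v], and its only neighbour in [L] and
    [U] is [u1]. Hence [w] is low as soon as [y1] has been exchanged with [z] and
    [u1] has left, which makes it adjacent to [v]. *)
Lemma pool_false : False.
Proof.
have [y0 y0X y0l] := meager_low mX X0.
have y0L : y0 \in L by rewrite inE y0X.
have [x0 x0X y0x0] : exists2 x, x \in X & adj y0 x.
  by apply: deg_in_gt0; move: (L_deg y0L) (t_ge2 s y0); clia.
have x0L : x0 \in X :\: L.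
  by rewrite inE x0X andbT; apply/negP => x0L; move: (L_indep y0L x0L); rewrite y0x0.
have [|u uXL ul] := meager_low (meager_sub (subsetDl X L) mX).
  by apply/set0Pn; exists x0.
pose U := [set u in X :\: L | deg_in (X :\: L) u < t s u].
have UX : U \subset X :\: L by apply/subsetP => x; rewrite inE => /andP[].
have [y yL uy] := has_partner uXL ul.
have [uniq_y _ vu] := partner uXL ul yL uy.
have /setDP[uX uL] := uXL.
have yX := subsetP LX y yL.
have [x1 x1Xy ux1] : exists2 x, x \in X :\ y & adj u x.
  apply: deg_in_gt0; move: uL; rewrite inE uX /= -leqNgt.
  move: (deg_in_rem u yX) (mult_le_max u y) (t_ge2 s u); rewrite (L_simple yL).
  by clia.
have [x1y x1X] : x1 != y /\ x1 \in X by move: x1Xy; rewrite !inE => /andP[].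
have x1XLU : x1 \in (X :\: L) :\: U.
  have x1L : x1 \notin L.
    by apply: contraNN x1y => x1L; rewrite (uniq_y x1).
  rewrite inE [x1 \in X :\: L]inE x1L x1X /= andbT.
  apply/negP; rewrite inE => /andP[x1XL x1l].
  have [y1 y1L x1y1] := has_partner x1XL x1l.
  have [_ _ vx1] := partner x1XL x1l y1L x1y1.
  move: x1y; rewrite (@edge_common_nbr _ hG v u x1 y) ?eqxx //; exact: L_adj.
have [|w wXLU wl] := meager_low (meager_sub (subset_trans (subsetDl _ U) (subsetDl X L)) mX).
  by apply/set0Pn; exists x1.
have /setDP[wXL wU] := wXLU; have /setDP[wX wL] := wXL.
have [u1 u1U wu1] : exists2 x, x \in U & adj w x.
  apply: deg_in_gt0; move: wU; rewrite inE wXL /= -leqNgt.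
  by move: wl (deg_in_split w UX); clia.
have /andP[u1XL u1l] : (u1 \in X :\: L) && (deg_in (X :\: L) u1 < t s u1).
  by move: u1U; rewrite inE.
have [y1 y1L u1y1] := has_partner u1XL u1l.
have [uniq_y1 u1low vu1] := partner u1XL u1l y1L u1y1.
have /setDP[u1X u1L] := u1XL.
have y1X := subsetP LX y1 y1L; have vy1 := L_adj y1L.
have wy1 : w != y1 by apply: contraNneq wL => ->.
have vw : ~~ adj v w.
  apply/negP => vw; move: wy1.
  by rewrite (@edge_common_nbr _ hG v u1 w y1) ?eqxx //; symm.
(* Another such neighbour [e] would give a quadrilateral [v u1 w e] on the edge
   [v u1] of the triangle [v u1 y1]. *)
have only_u1 e : e != y1 -> adj w e -> adj v e -> e = u1.
  move=> ey1 we ve; apply/eqP/negPn/negP => eu1.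
  apply: (@quad_no_triangle _ hG v u1 w e y1); try symm.
  by rewrite eq_sym; apply: neqX.
have ny1w : ~~ adj w y1.
  apply/negP => wy1'; move: vw.
  move: (@edge_common_nbr _ hG y1 u1 v w); rewrite ![adj y1 _]adjC vy1 u1y1.
  rewrite [adj u1 v]adjC vu1 wy1' [adj u1 w]adjC wu1 => /(_ isT isT isT isT isT) e.
  by have := neqX wX vX; rewrite e eqxx.
have u1y1' : u1 != y1 := adj_neq u1y1.
have nwz : ~~ adj w z.
  apply/negP => wz; have := neqX u1X zX.
  by rewrite (@only_u1 z) ?eqxx // eq_sym neqX.
have dL : deg_in L w = 0.
  apply/eqP; rewrite -leqn0 leqNgt; apply/negP => /deg_in_gt0[x xL wx].
  have [exy|xy1] := eqVneq x y1; first by move: ny1w; rewrite -exy wx.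
  by move: u1L; rewrite -(only_u1 x) // ?xL // L_adj.
have dU : deg_in U w <= mult w u1.
  apply: deg_in_le1 => x xU wx; apply: only_u1 => //.
    by apply: contraTneq xU => ->; rewrite inE [y1 \in _ :\: _]inE y1L.
  move: xU; rewrite inE => /andP[xXL xl].
  have [y2 y2L xy2] := has_partner xXL xl.
  by have [] := partner xXL xl y2L xy2.
have u1Xy : u1 \in X :\ y1 by rewrite !inE u1y1' u1X.
move: vw; rewrite (@exchange_adj y1 u1 w) //.
- apply/negP => y1z; have := neqX u1X zX.
  by rewrite (@edge_common_nbr _ hG v y1 u1 z) ?eqxx //; symm.
- apply/negP => u1z; have := neqX y1X zX.
  by rewrite (@edge_common_nbr _ hG v u1 y1 z) ?eqxx //; symm.
- by rewrite !inE (adj_neq wu1) wy1 wX.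
move: wl dL dU (mult_nadj nwz) (deg_in_split w LX) (deg_in_split w UX).
by move: (deg_in_rem w y1X) (deg_in_rem w u1Xy); clia.
Qed.

End Pool.

(** * Moves between optimal states *)

Section Critical.
Variables (G : multigraph) (t : bool -> G -> nat).
Hypothesis hG : quadrilaterals_isolated G.
Hypothesis t_ge2 : forall s x, 2 <= t s x.
(** [deg_tight] is the degree condition with equality, and [one_meager] says that
    there is no feasible pair of disjoint sets. *)
Hypothesis deg_tight :
  forall x : G, deg x + 3 = t true x + t false x + 2 * max_mult x.
Hypothesis one_meager :
  forall X Y : {set G}, [disjoint X & Y] -> meager t true X || meager t false Y.

Implicit Types (X Y : {set G}) (u v w x y z p : G) (s r : bool) (c : state G).

Lemma one_meager_sides s r X Y : s != r -> [disjoint X & Y] ->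
  meager t s X || meager t r Y.
Proof.
case: s; case: r => // _ dXY; first exact: one_meager.
by rewrite orbC one_meager // disjoint_sym.
Qed.

Lemma center_None c v : is_state t c v -> c v = None.
Proof. by case=> _ /(_ v); rewrite eqxx => /eqP. Qed.

Lemma low_neq_center c v s x : is_state t c v -> low t c s x -> x != v.
Proof. by move=> cv /low_side cx; case: cv => _ <-; rewrite cx. Qed.

(** For the centre itself the excesses over [t s v - 1] and [t r v - 1] thus add
    up to [2 * max_mult v - 1]. *)
Lemma state_deg c v s r x : is_state t c v -> s != r ->
  sdeg c s x + sdeg c r x + mult x v + 3 = t s x + t r x + 2 * max_mult x.
Proof.
move=> [gc cN] sr.
have : deg x = mult x v + (sdeg c true x + sdeg c false x).
  apply: deg_setT.
  - apply/pred0P => y /=; rewrite !in_side.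
    by case: (c y) => // -[]; rewrite ?(inj_eq Some_inj).
  - by rewrite inE !in_side; have := cN v; rewrite eqxx => /eqP ->.
  apply/setP => y; rewrite !inE -cN; case: (c y) => // -[] //.
have := deg_tight x; case: s sr; case: r => //= _; lia.
Qed.

Lemma max_mult_gt0 x : 0 < max_mult x.
Proof.
rewrite lt0n; apply/negP => /eqP m0.
have := deg_tight x; have := t_ge2 true x; have := t_ge2 false x.
rewrite m0 /deg deg_inE big1 => [|u _]; first by lia.
by have := mult_le_max u x; rewrite m0 mult_sym; lia.
Qed.

Lemma optimal_ge c v c' v' :
  optimal t c v -> is_state t c' v' -> potential t c <= potential t c' -> optimal t c' v'.
Proof. by move=> [_ h] c'v' le; split=> // c2 v2 /h h2; apply: leq_trans le. Qed.

Lemma total_pull c s z : good t c -> (forall x, c x != None) -> low t c s z ->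
  is_state t (upd c z None) z.
Proof.
move=> gc cN zl; split; first exact: good_pull.
by move=> x; rewrite updE; case: (x == z); last exact: negPf.
Qed.

(** Without a centre, a low vertex can be taken as the centre, which does not
    decrease the potential. *)
Lemma total_bound c0 v0 c s z : optimal t c0 v0 -> good t c ->
  (forall x, c x != None) -> low t c s z ->
  potential t c + 2 * (t s z - 1 - sdeg c s z) <= potential t c0.
Proof.
move=> [_ h] gc cN zl; have /h := total_pull gc cN zl.
have := potential_pull t (low_side zl); have := low_lt zl; have := t_ge2 s z; lia.
Qed.

Lemma total_low c0 v0 c s z : optimal t c0 v0 -> good t c ->
  (forall x, c x != None) -> potential t c = potential t c0 -> low t c s z ->
  sdeg c s z + 1 = t s z /\ optimal t (upd c z None) z.
Proof.
move=> oc gc cN e zl; have := total_bound oc gc cN zl; have := low_lt zl.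
have := potential_pull t (low_side zl); have := t_ge2 s z => ? ? ? ?.
split; first by lia.
by apply: (optimal_ge oc (total_pull gc cN zl)); lia.
Qed.

Lemma push_total c v s : is_state t c v -> forall x, upd c v (Some s) x != None.
Proof.
by move=> [_ cN] x; rewrite updE; case: (x =P v) => [_|/eqP xv]; rewrite ?cN.
Qed.

(** A vertex of this kind can go to the other side without changing the
    potential. *)
Definition loose c s r v z :=
  [/\ max_mult z = 1, mult v z = 1, sdeg c s z + 1 = t s z & sdeg c r z + 1 = t r z].

Lemma amove_comm c v s z : z != v ->
  amove c v s z = upd (upd c z None) v (Some s).
Proof.
move=> zv; apply/ffunP => x; rewrite !updE.
by case: (x =P z) => [->|//]; rewrite (negPf zv).
Qed.

Lemma amove_state c v s z : is_state t c v -> low t c s z ->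
  meager t s (side (amove c v s z) s) -> is_state t (amove c v s z) z.
Proof.
move=> sc zl m; have zv := low_neq_center sc zl; split.
  move=> o; have [->//|os] := eqVneq o s.
  rewrite amove_comm // side_out ?Some_neq 1?eq_sym //.
  rewrite side_out //; apply: meager_sub (proj1 sc o).
  by apply: (subset_trans (subD1set _ _)); apply: subD1set.
move=> x; rewrite amove_comm // !updE; case: (x =P v) => [->|/eqP xv].
  by rewrite [v == z]eq_sym (negPf zv).
by case: (x == z) => //; case: sc => _ ->; apply: negPf.
Qed.

Lemma amove_meager c v s z : is_state t c v -> low t c s z ->
  sdeg c s v + 1 <= t s v + mult v z -> meager t s (side (amove c v s z) s).
Proof.
move=> sc zl le; rewrite amove_comm ?(low_neq_center sc zl) // side_in.
apply: meager_add; first by apply: good_pull; case: sc.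
by have := sdeg_pull v (low_side zl); rewrite -/(sdeg (upd c z None) s v); lia.
Qed.

Lemma potential_amove c v s z : is_state t c v -> low t c s z ->
  potential t (amove c v s z) + 2 * (t s v - 1) + 2 * (sdeg c s z + mult v z) =
  potential t c + 2 * sdeg c s v + 2 * (t s z - 1).
Proof.
move=> sc zl; have cv := center_None sc; have zv := low_neq_center sc zl.
have := potential_push t s cv.
have := @potential_pull _ t (upd c v (Some s)) z s; rewrite upd_neq // (low_side zl) => /(_ erefl).
by rewrite -/(amove c v s z) (sdeg_push s z cv) [mult z v]mult_sym; lia.
Qed.

Lemma amove_optimal c v s z : optimal t c v -> low t c s z ->
  t s z + sdeg c s v = mult v z + sdeg c s z + t s v -> optimal t (amove c v s z) z.
Proof.
move=> oc zl e; have [sc _] := oc.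
have := potential_amove sc zl; have := low_lt zl; have := t_ge2 s v => ? ? ?.
apply: (optimal_ge oc); last by lia.
by apply: amove_state => //; apply: amove_meager => //; lia.
Qed.

Lemma shift_state c v s r z : is_state t c v -> s != r -> low t c s z ->
  meager t r (side (upd c z (Some r)) r) -> is_state t (upd c z (Some r)) v.
Proof.
move=> sc sr zl m; split.
  move=> o; have [->//|ro] := eqVneq o r.
  rewrite side_out ?Some_neq 1?eq_sym //.
  by apply: meager_sub (proj1 sc o); apply: subD1set.
move=> x; rewrite updE; case: (x =P z) => [->|_]; last by case: sc.
by rewrite eq_sym (negPf (low_neq_center sc zl)).
Qed.

Lemma potential_shift c s r z : s != r -> low t c s z ->
  potential t (upd c z (Some r)) + 2 * (t r z - 1) + 2 * sdeg c s z =
  potential t c + 2 * (t s z - 1) + 2 * sdeg c r z.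
Proof.
move=> sr zl; have cz := low_side zl; have := potential_pull t cz.
have := @potential_push _ t (upd c z None) z r (upd_eq _ _ _).
by rewrite upd_upd (sdeg_pull_other z sr cz); lia.
Qed.

Lemma loose_shift c v s r z : optimal t c v -> s != r -> low t c s z ->
  loose c s r v z -> optimal t (upd c z (Some r)) v.
Proof.
move=> oc sr zl [_ _ e1 e2]; have [sc _] := oc.
have := potential_shift sr zl => ?; apply: (optimal_ge oc); last by lia.
apply: (@shift_state _ _ s) => //; rewrite side_in; apply: meager_add; first by case: sc.
by rewrite -/(sdeg c r z); lia.
Qed.

(** If [z] reaches its threshold on side [r], then it cannot be moved there, as
    this would increase the potential; so side [r] with [z] is not meager, hence
    side [s] with [v] in place of [z] is, and the potential of that state gives
    the inequality. Otherwise the degree of [z] leaves no choice but equality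
    everywhere. *)
Lemma low_cases c v s r z : optimal t c v -> s != r -> t s v <= sdeg c s v ->
  low t c s z ->
  (t r z <= sdeg c r z /\ t s z + sdeg c s v <= mult v z + sdeg c s z + t s v) \/
  loose c s r v z.
Proof.
move=> oc sr iv zl; have [sc mx] := oc; have cz := low_side zl.
have cv := center_None sc; have zv := low_neq_center sc zl.
have zlt := low_lt zl.
have [le|lt] := leqP (t r z) (sdeg c r z); [left; split=> // | right].
  have nm : ~~ meager t r (side (upd c z (Some r)) r).
    apply/negP => m; have := mx _ _ (shift_state sc sr zl m).
    by have := potential_shift sr zl; have := t_ge2 s z; have := t_ge2 r z; lia.
  have /orP[m|] : meager t s (side (amove c v s z) s) ||
      meager t r (side (upd c z (Some r)) r); last by rewrite (negPf nm).
    apply: one_meager_sides => //; apply/pred0P => x /=.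
    rewrite !in_side !updE; case: (x == z) => //.
    case: (x =P v) => [->|_]; first by rewrite cv andbF.
    by case: (c x) => // o; apply/negP => /andP[/eqP-> /eqP[]] /eqP; apply/negP.
  have := mx _ _ (amove_state sc zl m); have := potential_amove sc zl.
  by have := t_ge2 s v; lia.
have := state_deg z sc sr; have := mult_le_max v z; rewrite [mult z v]mult_sym.
have := max_mult_gt0 z; split; lia.
Qed.

(** * The heavy side of the centre *)

(** The excesses of the centre over [t s v - 1] and [t r v - 1] add up to
    [2 * max_mult v - 1]; a state is normalized if they are [max_mult v], on the
    heavy side, and [max_mult v - 1], on the light side. Then a low vertex of the
    heavy side that is not loose can be exchanged with the centre. *)
Definition heavy c s v := optimal t c v /\ sdeg c s v + 1 = t s v + max_mult v.

Lemma optimal_center c v : optimal t c v -> c v = None.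
Proof. by case=> sc _; apply: center_None sc. Qed.

Lemma optimal_adj c v s r y : optimal t c v -> s != r -> t s v <= sdeg c s v ->
  low t c s y -> adj v y.
Proof.
move=> oc sr ge yl; rewrite /adj.
case: (low_cases oc sr ge yl) => [[_]|[_ -> _ _] //].
by move: (low_lt yl) ge; clia.
Qed.

Lemma heavy_optimal c s v : heavy c s v -> optimal t c v.
Proof. by case. Qed.

Lemma heavy_center c s v : heavy c s v -> c v = None.
Proof. by move/heavy_optimal/optimal_center. Qed.

Lemma heavy_ge c s v : heavy c s v -> t s v <= sdeg c s v.
Proof. by case=> _; move: (max_mult_gt0 v); clia. Qed.

Lemma heavy_light c s r v : heavy c s v -> s != r ->
  sdeg c r v + 2 = t r v + max_mult v.
Proof.
move=> [[sc _] e] sr; have := state_deg v sc sr.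
by rewrite mult_loopless; move: e; clia.
Qed.

Lemma heavy_low c s r v y : heavy c s v -> s != r -> low t c s y ->
  [/\ sdeg c s y + 1 = t s y, adj v y &
    (mult v y = max_mult v /\ t r y <= sdeg c r y) \/ loose c s r v y].
Proof.
move=> hc sr yl; have [oc e] := hc; have ge := heavy_ge hc.
have vy := optimal_adj oc sr ge yl.
case: (low_cases oc sr ge yl) => [[le1 le2]|lo].
  have mv := mult_le_max y v; rewrite mult_sym in mv; have := low_lt yl => lt.
  split=> //; first by move: e mv lt le2; clia.
  by left; split=> //; move: e mv lt le2; clia.
by split=> //; [case: lo | right].
Qed.

Lemma heavy_shift c s r v y : heavy c s v -> s != r -> low t c s y ->
  loose c s r v y -> heavy (upd c y (Some r)) r v.
Proof.
move=> hc sr yl lo; split; first exact: loose_shift (heavy_optimal hc) sr yl lo.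
rewrite (sdeg_shift_other v sr (low_side yl)); case: lo => _ -> _ _.
by move: (heavy_light hc sr); clia.
Qed.

Lemma heavy_amove c s r v y : heavy c s v -> s != r -> low t c s y ->
  mult v y = max_mult v -> optimal t (amove c v s y) y.
Proof.
move=> hc sr yl m; have [e _ _] := heavy_low hc sr yl; have [oc e'] := hc.
by apply: amove_optimal => //; move: e e' m (low_lt yl); clia.
Qed.

Lemma side_has_low c s x : good t c -> 0 < sdeg c s x -> exists y, low t c s y.
Proof. by move=> gc /sdeg_gt0[y cy _]; apply: good_low gc cy. Qed.

Lemma heavy_has_low c s v : heavy c s v -> exists y, low t c s y.
Proof.
move=> hc; have [[[gc _] _] _] := hc; apply: (@side_has_low _ _ v) => //.
by move: (heavy_ge hc) (t_ge2 s v); clia.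
Qed.

Lemma low_exists_leave c s x y : good t c -> c y = Some s ->
  mult x y < sdeg c s x -> exists u, low t (upd c y None) s u.
Proof.
move=> gc cy lt; apply: (@side_has_low _ _ x); first exact: good_pull.
by move: lt (sdeg_pull x cy); clia.
Qed.

(** The new place [o] of [y] is left open: it is the other side or [None]. *)
Lemma sdeg_leave c s y o x : c y = Some s -> o != Some s ->
  sdeg (upd c y o) s x + mult x y = sdeg c s x.
Proof.
move=> cy os; have := sdeg_upd c y o s x.
by rewrite cy eqxx (negPf os) mul1n mul0n addn0.
Qed.

Lemma low_leave c s y o u : o != Some s ->
  low t (upd c y o) s u = low t (upd c y None) s u.
Proof.
move=> os; rewrite /low /sdeg !side_out // !updE.
by case: (u == y); rewrite // (negPf os).
Qed.

Lemma low_leaveP c s y o u : o != Some s ->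
  low t (upd c y o) s u -> u != y /\ c u = Some s.
Proof.
move=> os /low_side; rewrite updE; case: eqP => [_ e|/eqP //].
by rewrite e eqxx in os.
Qed.

(** Only the loss of [y] can have made [u] low. *)
Lemma low_new c s y o u : c y = Some s -> o != Some s ->
  low t (upd c y o) s u -> ~~ low t c s u -> adj u y.
Proof.
move=> cy os ul; have [_ cu] := low_leaveP os ul.
rewrite (lowE t cu) -leqNgt /adj; move: (low_lt ul) (sdeg_leave u cy os); clia.
Qed.

Lemma low_stays c s y o u : c y = Some s -> o != Some s -> u != y ->
  low t c s u -> low t (upd c y o) s u.
Proof.
move=> cy os uy ul; rewrite lowU ?(low_side ul) //.
by move: (low_lt ul) (sdeg_leave u cy os); clia.
Qed.

(** If the excess on side [s] is larger than [max_mult v], then all low vertices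
    there are loose, and moving one across lowers the excess by one. *)
Lemma heavy_exists c v : optimal t c v -> exists c' s, heavy c' s v.
Proof.
move=> oc.
have step n : forall s r c, s != r -> optimal t c v -> sdeg c s v + 1 = n + t s v + max_mult v ->
    exists c' s, heavy c' s v.
  elim: n => [|n IH] s r c1 sr oc1 e; first by exists c1, s.
  have ge : t s v <= sdeg c1 s v.
    by move: e (max_mult_gt0 v); clia.
  have [[gc _] _] := oc1.
  have [y yl] : exists y, low t c1 s y.
    by apply: (@side_has_low _ _ v) => //; move: ge (t_ge2 s v); clia.
  case: (low_cases oc1 sr ge yl) => [[_ le]|lo].
    have := mult_le_max y v; rewrite mult_sym; move: le (low_lt yl) e; clia.
  have oc2 := loose_shift oc1 sr yl lo; apply: (IH s r _ sr oc2).
  case: lo => _ m _ _; move: (sdeg_shift v sr (low_side yl)) e; rewrite m; clia.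
have [sc _] := oc; have := state_deg v sc (isT : true != false).
rewrite mult_loopless => e.
have [le|lt] := leqP (t true v + max_mult v) (sdeg c true v + 1).
  apply: (step (sdeg c true v + 1 - t true v - max_mult v) true false _ _ oc) => //.
  by move: le; clia.
apply: (step (sdeg c false v + 1 - t false v - max_mult v) false true _ _ oc) => //.
by move: e lt; clia.
Qed.

(** ** Pools of shiftable vertices *)

Lemma state_pool_false c s r v z : is_state t c v -> s != r ->
  c z = Some r -> adj v z -> (exists y, low t c s y) ->
  (forall y, low t c s y -> [/\ adj v y, max_mult y = 1 & sdeg c s y + 1 = t s y]) ->
  (forall y y', low t c s y -> low t c s y' -> ~~ adj y y') ->
  (forall y u, low t c s y -> low t (upd c y (Some r)) s u -> adj v u) ->
  (forall y y' u, low t c s y -> ~~ adj y z ->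
     low t (upd c y (Some r)) s y' -> ~~ adj y' z ->
     low t (upd (upd (upd c y (Some r)) z (Some s)) y' (Some r)) s u ->
     u != z -> adj v u) ->
  False.
Proof.
move=> sc sr cz vz [y0 y0l] h1 h2 h3 h4; have cv := center_None sc.
have rsN : Some r != Some s by rewrite Some_neq // eq_sym.
have zX : z \notin side c s by rewrite in_side cz.
have inL y : (y \in [set x in side c s | deg_in (side c s) x < t s x]) = low t c s y.
  by rewrite !inE.
have E y : deg_in (side c s :\ y) = sdeg (upd c y (Some r)) s by rewrite /sdeg side_out.
apply: (@pool_false G t s hG t_ge2 (side c s) v z) => //.
- by case: sc.
- by rewrite in_side cv.
- by apply/set0Pn; exists y0; rewrite in_side (low_side y0l).
- by move=> y; rewrite inL => /h1[].
- by move=> y y'; rewrite !inL; apply: h2.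
- by move=> y; rewrite inL => /h1[].
- by move=> y; rewrite inL => /h1[_ _ <-]; rewrite leqnn.
- move=> y u; rewrite inL => yl; rewrite inE in_set1 in_side => /andP[uy /eqP cu].
  by rewrite E => ul; apply: (h3 y) => //; rewrite lowU.
move=> y y' u; rewrite inL => yl yz; rewrite inE in_set1 in_side => /andP[y'y /eqP cy'].
rewrite E => y'l y'z; rewrite !inE => /and3P[uy' uy /eqP cu] ul.
have uz : u != z by rewrite (val_neq cu cz) ?Some_neq.
apply: (h4 y y') => //; first by rewrite lowU.
have y'z' : y' != z by rewrite (val_neq cy' cz) ?Some_neq.
have zy : z != y by rewrite (val_neq cz (low_side yl)).
rewrite lowU ?upd_neq //; apply: leq_ltn_trans ul.
rewrite /sdeg side_out // side_in side_out //.
have -> : (z |: side c s :\ y) :\ y' = z |: (side c s :\ y :\ y').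
  by apply/setP => x; rewrite !inE; case: eqVneq => // ->; case: eqVneq => // e; rewrite e eqxx in y'z'.
by rewrite deg_in_add ?[mult u z + _]addnC // !inE cz (negPf rsN) !andbF.
Qed.

(** ** Triangles through the centre *)

(** [p] will serve as a pendant of the triangle. Both [z] and [p] are neighbours
    of [v], being low on its heavy side. *)
Definition tri c s r v z y p :=
  [/\ s != r, heavy c s v, [/\ low t c s z, low t c s p & p != z], low t c r y &
    [/\ adj v z, adj z y, adj y v, mult v z = max_mult v & max_mult p = 1]].

Lemma tri_good c s r v z y p : tri c s r v z y p -> good t c.
Proof. by case=> _ [[[]]]. Qed.

Lemma tri_sides c s r v z y p : tri c s r v z y p ->
  [/\ s != r, c v = None, c z = Some s, c p = Some s & c y = Some r].
Proof.
by case=> sr /heavy_center cv [/low_side cz /low_side cp _] /low_side cy _.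
Qed.

Lemma tri_adj c s r v z y p : tri c s r v z y p ->
  [/\ adj v z, adj z y, adj y v, adj v p & p != z].
Proof.
by case=> sr hc [_ pl pz] _ [vz zy yv _ _]; split=> //; case: (heavy_low hc sr pl).
Qed.

Lemma tri_nadj c s r v z y p : tri c s r v z y p -> ~~ adj p z /\ ~~ adj p y.
Proof.
move=> T; have [sr cv cz cp cy] := tri_sides T; have [vz zy yv vp pz] := tri_adj T.
have nyp : y != p by rewrite (val_neq cy cp) ?Some_neq // eq_sym.
split; apply/negP => a.
  by move: nyp; rewrite (@edge_common_nbr _ hG v z y p) ?eqxx //; symm.
by move: pz; rewrite (@edge_common_nbr _ hG v y p z) ?eqxx //; symm.
Qed.

(** A vertex that is low in side [s] without [p] and [z] must be adjacent to [z],
    as [z] was the only low vertex without [p]. It is not adjacent to [p], which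
    would give a quadrilateral on the edge [v z]. *)
Lemma tri_pendant c s r v z y p : tri c s r v z y p ->
  (forall x, low t (upd c p None) s x -> x = z) ->
  exists w, adj w z /\ low t (upd c z None) s w.
Proof.
move=> T only; have [sr cv cz cp cy] := tri_sides T.
have [vz zy yv vp pz] := tri_adj T; have [npz npy] := tri_nadj T.
have [_ hc [zl pl _] _ _] := T; have gc := tri_good T.
set c1 := upd c p None.
have zp : z != p by rewrite eq_sym.
have c1z : c1 z = Some s by rewrite upd_neq.
have [x cx zx] : exists2 x, c1 x = Some s & adj z x.
  apply: sdeg_gt0; have [e _ _] := heavy_low hc sr zl.
  have := sdeg_pull z cp; rewrite [mult z p]mult_sym (mult_nadj npz).
  by move: e (t_ge2 s z); rewrite -/c1; clia.
have xz : x != z by rewrite eq_sym adj_neq.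
have [w wl] : exists w, low t (upd c1 z None) s w.
  by apply: (@good_low _ t _ s x); [do 2! apply: good_pull | rewrite upd_neq].
have [wz c1w] := low_leaveP (isT : None != Some s) wl.
have [wp cw] : w != p /\ c w = Some s.
  by move: c1w; rewrite /c1 updE; case: eqP => // /eqP.
have az : adj w z.
  apply: (low_new c1z _ wl) => //; apply/negP => wl'.
  by move: wz; rewrite (only _ wl') eqxx.
exists w; split=> //.
have nwp : ~~ adj w p.
  apply/negP => wp'; have wv : w != v by apply: val_neq cw cv _.
  by apply: (@triangle_quad _ hG v z y p w); symm.
rewrite lowU //; apply: leq_ltn_trans (low_lt wl).
move: (sdeg_pull w cz) (sdeg_pull w c1z) (sdeg_pull w cp) (mult_nadj nwp).
by rewrite -/c1; clia.
Qed.

Lemma low_amove_other c v s r z x : s != r -> c v = None -> c z = Some s ->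
  low t (amove c v s z) r x = low t c r x.
Proof.
move=> sr cv cz; rewrite /low (sdeg_amove_other x sr cv cz) /amove !updE.
case: (x =P z) => [->|_]; first by rewrite cz Some_neq.
by case: (x =P v) => [->|//]; rewrite cv Some_neq.
Qed.

Lemma low_shift_other c s r p x : s != r -> c p = Some s -> c x = Some r ->
  low t c r x -> ~~ adj x p -> low t (upd c p (Some r)) r x.
Proof.
move=> sr cp cx xl xp; have nxp : x != p by rewrite (val_neq cx cp) ?Some_neq // eq_sym.
rewrite lowU // (sdeg_shift_other x sr cp) (mult_nadj xp) addn0; exact: low_lt.
Qed.

Lemma tri_shift_low c s r v z y p : tri c s r v z y p ->
  low t (upd c p (Some r)) r y.
Proof.
move=> T; have [sr cv cz cp cy] := tri_sides T.
have [_ _ _ yl _] := T; apply: (low_shift_other sr) => //.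
by rewrite adjC; case: (tri_nadj T).
Qed.

Lemma tri_shift c s r v z y p : tri c s r v z y p -> loose c s r v p ->
  mult v y = max_mult v -> tri (upd c p (Some r)) r s v y z p.
Proof.
move=> T lo my; have [sr cv cz cp cy] := tri_sides T.
have [vz zy yv vp pz] := tri_adj T.
have [_ hc [zl pl _] yl [_ _ _ _ mp]] := T.
split; first by rewrite eq_sym.
- exact: (heavy_shift hc sr pl lo).
- split; first exact: tri_shift_low T.
    rewrite /low upd_eq eqxx /= (sdeg_shift_other p sr cp) mult_loopless addn0.
    by case: lo => _ _ _; clia.
  by rewrite (val_neq cp cy) ?Some_neq.
- by apply: low_stays; rewrite ?Some_neq // eq_sym.
- by split=> //; symm.
Qed.

Lemma amove_low_center c s v y : heavy c s v -> low t c s y ->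
  mult v y = max_mult v -> low t (amove c v s y) s v.
Proof.
move=> [[sc _] e] yl my; have cv := center_None sc; have cy := low_side yl.
have vy : v != y by rewrite eq_sym (low_neq_center sc yl).
rewrite /low amove_v // eqxx /=; move: (sdeg_amove v cv cy) e my.
by rewrite mult_loopless; clia.
Qed.

Lemma amove_low_leave c s v y w : c v = None -> c y = Some s ->
  low t (upd c y None) s w -> ~~ adj w v -> low t (amove c v s y) s w.
Proof.
move=> cv cy wl nwv; have [wy cw] := low_leaveP (isT : None != Some s) wl.
have wv : w != v by apply: val_neq cw cv _.
rewrite /low amove_neq // cw eqxx /=; apply: leq_ltn_trans (low_lt wl).
by move: (sdeg_amove w cv cy) (sdeg_pull w cy) (mult_nadj nwv); clia.
Qed.

(** The pendant [w] of [z] becomes low when [z] leaves, and remains low when [v]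
    enters, since the edge [v z] has [y] as its only common neighbour. *)
Lemma tri_amove_low c s r v z y p w : tri c s r v z y p ->
  adj w z -> low t (upd c z None) s w ->
  [/\ low t (amove c v s z) s v, low t (amove c v s z) s w,
      low t (amove c v s z) r y & w != v].
Proof.
move=> T wz wl; have [sr cv cz cp cy] := tri_sides T.
have [vz zy yv vp pz] := tri_adj T.
have [_ hc [zl _ _] yl [_ _ _ mz _]] := T.
have [nwz cw] := low_leaveP (isT : None != Some s) wl.
have wv : w != v by apply: val_neq cw cv _.
have nvw : ~~ adj w v.
  apply/negP => a; have := val_neq cy cw; rewrite Some_neq 1?eq_sym // => /(_ isT).
  by rewrite (@edge_common_nbr _ hG v z y w) ?eqxx //; symm.
split=> //.
- exact: amove_low_center.
- exact: amove_low_leave.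
by rewrite low_amove_other.
Qed.

Lemma tri_amove c s r v z y p w : tri c s r v z y p ->
  adj w z -> low t (upd c z None) s w -> max_mult w = 1 ->
  heavy (amove c v s z) s z -> mult z v = max_mult z ->
  tri (amove c v s z) s r z v y w.
Proof.
move=> T wz wl mw hz mz; have [vl wl' yl wv] := tri_amove_low T wz wl.
have [sr _ _ _ _] := T; have [vz zy yv vp pz] := tri_adj T.
by split=> //; split=> //; symm.
Qed.

(** * Centres incident with a multiple edge *)


(** Triangles whose centre has a multiple edge. *)
Definition mtri c s r v z y p := tri c s r v z y p /\ 2 <= max_mult v.

(** With a multiple edge at the centre even the excess on the light side is
    positive. *)
Lemma light_adj c s r v y : heavy c s v -> s != r -> 2 <= max_mult v ->
  low t c r y -> adj v y.
Proof.
move=> hc sr m2 yl; have rs : r != s by rewrite eq_sym.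
apply: (optimal_adj (heavy_optimal hc) rs _ yl).
by move: (heavy_light hc sr) m2; clia.
Qed.

Lemma movable_not_loose c s r v z : 2 <= max_mult v ->
  mult v z = max_mult v -> ~ loose c s r v z.
Proof. by move=> m2 mz [_ m1 _ _]; move: m2 mz m1; clia. Qed.

(** After the exchange of [v] and [z], [z] is a centre that reaches its threshold
    in side [r]. *)
Lemma movable_adj c s r v z y : heavy c s v -> s != r -> 2 <= max_mult v ->
  low t c s z -> mult v z = max_mult v -> low t c r y -> adj z y.
Proof.
move=> hc sr m2 zl mz yl; have rs : r != s by rewrite eq_sym.
have [_ _ [[_ le]|/(movable_not_loose m2 mz)//]] := heavy_low hc sr zl.
have oz := heavy_amove hc sr zl mz.
have cv := heavy_center hc; have cz := low_side zl.
apply: (optimal_adj oz rs); first by rewrite (sdeg_amove_other z sr cv cz).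
by rewrite low_amove_other.
Qed.

Lemma movable_adj_uniq c s r v z y x : heavy c s v -> s != r ->
  2 <= max_mult v -> low t c s z -> mult v z = max_mult v ->
  low t c r y -> low t c r x -> x = y.
Proof.
move=> hc sr m2 zl mz yl xl; have [_ vz _] := heavy_low hc sr zl.
apply: (@edge_common_nbr _ hG v z) => //.
- exact: light_adj hc sr m2 xl.
- exact: movable_adj hc sr m2 zl mz xl.
- exact: light_adj hc sr m2 yl.
- exact: movable_adj hc sr m2 zl mz yl.
Qed.

Lemma mtri_other c s r v z y p x : mtri c s r v z y p -> low t c r x -> x = y.
Proof.
move=> [[sr hc [zl _ _] yl [_ _ _ mz _]] m2].
exact: movable_adj_uniq hc sr m2 zl mz yl.
Qed.

Lemma mtri_loose c s r v z y p : mtri c s r v z y p -> loose c s r v p.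
Proof.
move=> [T m2]; have [_ npy] := tri_nadj T.
have [sr hc [_ pl _] yl _] := T; have [_ _ [[mp _]|//]] := heavy_low hc sr pl.
by move: npy; rewrite (movable_adj hc sr m2 pl mp yl).
Qed.

(** If [y] were loose, it could follow [p] (in the opposite direction) while the
    excess of [v] on side [r] stays positive. A vertex [u] that this makes low
    would be a second common neighbour of [v] and [y]. *)
Lemma mtri_movable c s r v z y p : mtri c s r v z y p -> mult v y = max_mult v.
Proof.
move=> M; have [T m2] := M; have [sr cv cz cp cy] := tri_sides T.
have rs : r != s by rewrite eq_sym.
have [vz zy yv vp pz] := tri_adj T; have [npz npy] := tri_nadj T.
have [_ hc [zl pl _] yl _] := T; have lo := mtri_loose M.
have h2 := heavy_shift hc sr pl lo; have yl2 := tri_shift_low T.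
have [_ _ [[//]|lo2]] := heavy_low h2 rs yl2; exfalso.
have o3 := loose_shift (heavy_optimal h2) rs yl2 lo2.
have [_ m1 _ _] := lo2; have gc := tri_good T.
have hl := heavy_light hc sr.
have [u ul] : exists u, low t (upd c y None) r u.
  by apply: (@low_exists_leave c r v y gc cy); move: hl m1 m2 (t_ge2 r v); clia.
have [uy cu] := low_leaveP (isT : None != Some r) ul.
have auy : adj u y.
  by apply: (low_new cy _ ul) => //; apply: contraNN uy => /(mtri_other M) ->.
have nup : ~~ adj u p.
  apply/negP => up; have uv : u != v by apply: val_neq cu cv _.
  have yp : p != y by rewrite (val_neq cp cy) ?Some_neq.
  by apply: (@triangle_quad _ hG v y z p u); symm.
have nu_p : u != p by rewrite (val_neq cu cp) ?Some_neq.
have ny_p : y != p by rewrite (val_neq cy cp) ?Some_neq.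
have c2y : upd c p (Some r) y = Some r by rewrite upd_neq.
have vu : adj v u.
  apply: (optimal_adj o3 rs).
    have := heavy_light hc sr; have := h2.2.
    by move: m1 m2 (sdeg_shift v rs c2y); clia.
  rewrite lowU ?upd_neq //; apply: leq_ltn_trans (low_lt ul).
  move: (sdeg_shift u rs c2y) (sdeg_shift_other u sr cp) (mult_nadj nup) (sdeg_pull u cy).
  by clia.
have := val_neq cz cu; rewrite Some_neq // => /(_ isT).
by rewrite (@edge_common_nbr _ hG v y z u) ?eqxx //; symm.
Qed.

Lemma mtri_shift c s r v z y p : mtri c s r v z y p ->
  mtri (upd c p (Some r)) r s v y z p.
Proof.
move=> M; have [T m2] := M; split=> //.
exact: (tri_shift T (mtri_loose M) (mtri_movable M)).
Qed.

Lemma mtri_only c s r v z y p x : mtri c s r v z y p ->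
  low t (upd c p None) s x -> x = z.
Proof.
move=> M xl; have M2 := mtri_shift M; apply: (mtri_other M2).
have [sr _ _ _ _] := M.1.
by rewrite low_leave // Some_neq // eq_sym.
Qed.

(** The excess of [z] on side [s] becomes [max_mult v]. If this is less than
    [max_mult z], then side [r] has at least the excess of a heavy side. *)
Lemma amove_heavy c s r v z : heavy c s v -> s != r -> 2 <= max_mult v ->
  low t c s z -> mult v z = max_mult v ->
  optimal t (amove c v s z) z /\
  (heavy (amove c v s z) s z /\ mult z v = max_mult z \/
   max_mult v < max_mult z /\
     t r z + max_mult z <= sdeg (amove c v s z) r z + 1).
Proof.
move=> hc sr m2 zl mz; have [ez _ _] := heavy_low hc sr zl.
have oz := heavy_amove hc sr zl mz; split=> //.
have cv := heavy_center hc; have cz := low_side zl.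
have := mult_le_max v z; rewrite mz leq_eqVlt => /orP[/eqP e|lt].
  left; split; last by rewrite mult_sym mz.
  split=> //; move: (sdeg_amove z cv cz); rewrite mult_loopless [mult z v]mult_sym.
  by move: ez mz e; clia.
right; split=> //; have [sz _] := oz.
have := state_deg z sz sr; rewrite mult_loopless.
move: (sdeg_amove z cv cz); rewrite mult_loopless [mult z v]mult_sym.
by move: ez mz lt; clia.
Qed.

(** If side [r] took over the excess, then [y] could be exchanged with [z] and
    would be adjacent to [w], giving a [K4_minus]. *)
Lemma mtri_amove c s r v z y p w : mtri c s r v z y p ->
  adj w z -> low t (upd c z None) s w -> mtri (amove c v s z) s r z v y w.
Proof.
move=> M wz wl; have [T m2] := M; have [sr cv cz cp cy] := tri_sides T.
have rs : r != s by rewrite eq_sym.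
have [vz zy yv vp pz] := tri_adj T; have [npz npy] := tri_nadj T.
have [_ hc [zl pl _] yl [_ _ _ mz _]] := T.
have [vl wl' yl' wv] := tri_amove_low T wz wl.
have nvw : v != w by rewrite eq_sym.
have [nwz cw] := low_leaveP (isT : None != Some s) wl.
have nwy : ~~ adj w y.
  by apply/negP => wy; move: nvw; rewrite (@edge_common_nbr _ hG z y v w) ?eqxx //; symm.
have my := mtri_movable M; have my1 := mult_le_max v y; have mz1 := mult_le_max v z.
have mz2 : 2 <= max_mult z by move: mz1 mz m2; clia.
have [oz [[hz mz']|[lt ge]]] := amove_heavy hc sr m2 zl mz.
  split=> //; apply: (tri_amove T) => //.
  have [_ _ [[mw _]|[]//]] := heavy_low hz sr wl'.
  by move: nwy; rewrite (movable_adj hz sr mz2 wl' mw yl').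
exfalso; have ge' : t r z <= sdeg (amove c v s z) r z by move: ge mz2; clia.
case: (low_cases oz rs ge' yl') => [[le1 le2]|[]].
  have lty := low_lt yl'; have mzy := mult_le_max y z; rewrite mult_sym in mzy.
  have hz : heavy (amove c v s z) r z by split=> //; move: le2 lty mzy ge; clia.
  have mzy' : mult z y = max_mult z by move: le2 lty mzy ge; clia.
  by move: nwy; rewrite adjC (movable_adj hz rs mz2 yl' mzy' wl').
by move: my my1 m2; clia.
Qed.

Lemma mtri_false c s r v z y p : ~ mtri c s r v z y p.
Proof.
apply: (triangle_false hG t_ge2) => {c s r v z y p}.
- by move=> c s r v z y p [T _]; apply: tri_good T.
- by move=> c s r v z y p [T _]; apply: tri_sides T.
- by move=> c s r v z y p [T _]; apply: tri_adj T.
- by move=> c s r v z y p [[_ _ _ _ []]].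
- by move=> c s r v z y p x; apply: mtri_only.
- by move=> c s r v z y p; apply: mtri_shift.
- move=> c s r v z y p M; apply: (tri_pendant M.1).
  by move=> x; apply: mtri_only M.
- by move=> c s r v z y p w; apply: mtri_amove.
Qed.

Lemma light_has_low c s r v : heavy c s v -> s != r -> 2 <= max_mult v ->
  exists z, low t c r z.
Proof.
move=> hc sr m2; have [[[gc _] _] _] := hc; apply: (@side_has_low _ _ v) => //.
by move: (heavy_light hc sr) m2 (t_ge2 r v); clia.
Qed.

(** The low vertices [z] of the light side are adjacent to [v] and [y], so there
    is just one. If there is a second low vertex [p] on the heavy side, it serves as
    pendant of [v]. If not, a vertex [u] that becomes low when [y] leaves is a
    pendant of [y], and the triangle is considered with centre [y]. *)
Lemma movable_false c s r v y : heavy c s v -> s != r -> 2 <= max_mult v ->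
  low t c s y -> mult v y = max_mult v -> False.
Proof.
move=> hc sr m2 yl my; have rs : r != s by rewrite eq_sym.
have [ey vy _] := heavy_low hc sr yl; have [[[gc _] _] _] := hc.
have [z zl] := light_has_low hc sr m2.
have vz := light_adj hc sr m2 zl; have yz := movable_adj hc sr m2 yl my zl.
have cy := low_side yl; have cz := low_side zl; have cv := heavy_center hc.
have [p /andP[pl py]|none] := pickP (fun p => low t c s p && (p != y)).
  apply: (@mtri_false c s r v y z p); split=> //; split=> //; split=> //; try symm.
  have [_ vp [[mp _]|[]//]] := heavy_low hc sr pl.
  have pz := movable_adj hc sr m2 pl mp zl.
  by move: py; rewrite (@edge_common_nbr _ hG v z p y) ?eqxx //; symm.
have only p : low t c s p -> p = y.
  by move=> pl; apply/eqP; move: (none p); rewrite pl; case: eqP.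
have [u ul] : exists u, low t (upd c y None) s u.
  apply: (@low_exists_leave c s y y gc cy).
  by rewrite mult_loopless; move: ey (t_ge2 s y); clia.
have [uy cu] := low_leaveP (isT : None != Some s) ul.
have auy : adj u y.
  by apply: (low_new cy _ ul) => //; apply: contraNN uy => /only ->.
have nuv : ~~ adj u v.
  apply/negP => uv; have := val_neq cz cu; rewrite Some_neq // => /(_ isT).
  by rewrite (@edge_common_nbr _ hG v y z u) ?eqxx //; symm.
have uv : u != v by apply: val_neq cu cv _.
have vl' := amove_low_center hc yl my.
have ul' := amove_low_leave cv cy ul nuv.
have zl' : low t (amove c v s y) r z by rewrite low_amove_other.
have nuz : ~~ adj u z.
  apply/negP => uz; move: uv.
  by rewrite (@edge_common_nbr _ hG y z u v) ?eqxx //; symm.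
have my1 := mult_le_max v y.
have my2 : 2 <= max_mult y by move: my my1 m2; clia.
have [oy [[hy my']|[lt ge]]] := amove_heavy hc sr m2 yl my.
  apply: (@mtri_false (amove c v s y) s r y v z u); split; last exact: my2.
  split=> //; split=> //; try symm.
  have [_ _ [[mu _]|[]//]] := heavy_low hy sr ul'.
  by move: nuz; rewrite (movable_adj hy sr my2 ul' mu zl').
have ge' : t r y <= sdeg (amove c v s y) r y by move: ge my2; clia.
case: (low_cases oy rs ge' zl') => [[le1 le2]|lo].
  have ltz := low_lt zl'; have mzy := mult_le_max z y; rewrite mult_sym in mzy.
  have hy : heavy (amove c v s y) r y by split=> //; move: le2 ltz mzy ge; clia.
  have mzy' : mult y z = max_mult y by move: le2 ltz mzy ge; clia.
  by move: nuz; rewrite adjC (movable_adj hy rs my2 zl' mzy' ul').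
have o3 := loose_shift oy rs zl' lo; have cz' := low_side zl'.
have [[gy _] _] := oy; have [_ m1 dz _] := lo.
have [w wl] : exists w, low t (upd (amove c v s y) z None) r w.
  apply: (@low_exists_leave _ r z z gy cz').
  by rewrite mult_loopless; move: dz (t_ge2 r z); clia.
have [wz cw] := low_leaveP (isT : None != Some r) wl.
have awz : adj w z.
  apply: (low_new cz' _ wl) => //; apply: contraNN wz => wl'.
  apply/eqP; apply: (movable_adj_uniq hc sr m2 yl my zl).
  by rewrite low_amove_other in wl'.
have yw : adj y w.
  apply: (optimal_adj o3 rs); last by rewrite low_leave // Some_neq.
  by move: (sdeg_shift y rs cz') ge m1 my2; clia.
have := val_neq (low_side vl') cw; rewrite Some_neq // => /(_ isT).
by rewrite (@edge_common_nbr _ hG y z v w) ?eqxx //; symm.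
Qed.

Lemma heavy_loose c s r v y : heavy c s v -> s != r -> 2 <= max_mult v ->
  low t c s y -> loose c s r v y.
Proof.
move=> hc sr m2 yl; have [_ _ [[my _]|//]] := heavy_low hc sr yl.
by case: (movable_false hc sr m2 yl my).
Qed.

(** Some low vertex [y] of the heavy side is not adjacent to [z]; when it is moved
    across, [z] finds itself on the heavy side. *)
Lemma light_loose c s r v z : heavy c s v -> s != r -> 2 <= max_mult v ->
  low t c r z -> loose c r s v z.
Proof.
move=> hc sr m2 zl; have rs : r != s by rewrite eq_sym.
have cz := low_side zl; have [[[gc _] _] _] := hc.
have vz := light_adj hc sr m2 zl.
have [y /andP[yl nzy]|none] := pickP (fun y => low t c s y && ~~ adj z y).
  have h' := heavy_shift hc sr yl (heavy_loose hc sr m2 yl).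
  have cy := low_side yl.
  have [] := heavy_loose h' rs m2 (low_shift_other sr cy cz zl nzy).
  rewrite (sdeg_shift_other z sr cy) => e1 e2 e3 e4; split=> //.
    by move: e3 (mult_nadj nzy); clia.
  by move: e4 (sdeg_shift z sr cy) (mult_nadj nzy); clia.
have all_adj y : low t c s y -> adj z y.
  by move=> yl; move: (none y); rewrite yl /=; case: (adj z y).
have [y yl] := heavy_has_low hc; have cy := low_side yl.
have lo := heavy_loose hc sr m2 yl; have h' := heavy_shift hc sr yl lo.
have [_ vy _] := heavy_low hc sr yl; have zy := all_adj y yl.
have [u ul] : exists u, low t (upd c y None) s u.
  apply: (@low_exists_leave c s y y gc cy).
  by rewrite mult_loopless; case: lo => _ _; move: (t_ge2 s y); clia.
have [uy cu] := low_leaveP (isT : None != Some s) ul.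
have vu : adj v u.
  by apply: (light_adj h' rs m2); rewrite low_leave // Some_neq.
have auy : adj u y.
  apply: (low_new cy _ ul) => //; apply/negP => ul'; move: uy.
  have zu := all_adj u ul'.
  by rewrite (@edge_common_nbr _ hG v z u y) ?eqxx //; symm.
have := val_neq cz cu; rewrite Some_neq // => /(_ isT).
by rewrite (@edge_common_nbr _ hG v y z u) ?eqxx //; symm.
Qed.

(** Now all low vertices are loose, and they can be moved across in any order
    while the excess of [v] stays positive on both sides. *)
Lemma optimal_center_simple c v : optimal t c v -> max_mult v = 1.
Proof.
move=> oc; have m0 := max_mult_gt0 v.
suff: ~~ (2 <= max_mult v) by move: m0; clia.
apply/negP => m2; have [{oc}c' [s hc]] := heavy_exists oc; move: c' hc => {}c hc.
pose r := ~~ s; have sr : s != r by case: s @r hc.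
have rs : r != s by rewrite eq_sym.
have [z zl] := light_has_low hc sr m2; have cz := low_side zl.
have vz := light_adj hc sr m2 zl.
have shiftP y : low t c s y -> heavy (upd c y (Some r)) r v.
  by move=> yl; apply: (heavy_shift hc sr yl (heavy_loose hc sr m2 yl)).
have [[sc _] _] := hc.
apply: (state_pool_false sc sr cz vz (heavy_has_low hc)).
- move=> y yl; have [mx m1 e _] := heavy_loose hc sr m2 yl.
  by split=> //; rewrite /adj m1.
- move=> y y' yl y'l; apply/negP => yy'.
  have y'y : y' != y by rewrite eq_sym adj_neq.
  have cy := low_side yl; have rsN : Some r != Some s by rewrite Some_neq.
  have [_ _ e1 _] := light_loose (shiftP y yl) rs m2 (low_stays cy rsN y'y y'l).
  have [_ _ e2 _] := heavy_loose hc sr m2 y'l.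
  by move: yy' e1 e2 (sdeg_shift y' sr cy); rewrite adjC /adj; clia.
- by move=> y u yl; apply: light_adj (shiftP y yl) rs m2.
move=> y y' u yl nyz y'l ny'z ul uz.
have h1 := shiftP y yl; have cy := low_side yl.
have nzy : ~~ adj z y by rewrite adjC.
have zl1 := low_shift_other sr cy cz zl nzy.
have h2 := heavy_shift h1 rs zl1 (heavy_loose h1 rs m2 zl1).
have y'l2 := low_shift_other rs (low_side zl1) (low_side y'l) y'l ny'z.
have h3 := heavy_shift h2 sr y'l2 (heavy_loose h2 sr m2 y'l2).
exact: light_adj h3 rs m2 ul.
Qed.

(** * Simple centres *)

Lemma heavy_simple c s v : heavy c s v -> max_mult v = 1.
Proof. by move/heavy_optimal/optimal_center_simple. Qed.

Lemma light_deg c s r v : heavy c s v -> s != r -> sdeg c r v + 1 = t r v.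
Proof.
by move=> hc sr; move: (heavy_light hc sr); rewrite (heavy_simple hc); clia.
Qed.

Lemma heavy_mult c s v y : heavy c s v -> adj v y -> mult v y = 1.
Proof.
move=> hc; have := mult_le_max y v; rewrite mult_sym (heavy_simple hc) /adj.
by clia.
Qed.

Lemma simple_loose c s r v y : heavy c s v -> s != r -> low t c s y ->
  loose c s r v y /\ heavy (amove c v s y) s y.
Proof.
move=> hc sr yl; have [e vy _] := heavy_low hc sr yl.
have m1 := heavy_mult hc vy; have mv := heavy_simple hc.
have oy : optimal t (amove c v s y) y.
  by apply: (heavy_amove hc sr yl); rewrite m1 mv.
have my := optimal_center_simple oy; have cv := heavy_center hc.
have [[sc _] _] := hc; split; last first.
  split=> //; move: (sdeg_amove y cv (low_side yl)).
  by rewrite mult_loopless mult_sym m1 my; move: e; clia.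
split=> //; have := state_deg y sc sr; rewrite mult_sym m1 my.
by move: e; clia.
Qed.

Lemma simple_shift c s r v y : heavy c s v -> s != r -> low t c s y ->
  heavy (upd c y (Some r)) r v /\ low t (upd c y (Some r)) r y.
Proof.
move=> hc sr yl; have [lo _] := simple_loose hc sr yl.
split; first exact: heavy_shift hc sr yl lo.
rewrite /low upd_eq eqxx /= (sdeg_shift_other y sr (low_side yl)) mult_loopless.
by case: lo => _ _ _; clia.
Qed.

(** ** Complete states *)

(** On the light side [v] is just one below its threshold: it can enter without
    changing the potential. *)
Lemma total_optimal c s r v o x : heavy c s v -> s != r ->
  low t (upd c v (Some r)) o x ->
  sdeg (upd c v (Some r)) o x + 1 = t o x /\ optimal t (upd (upd c v (Some r)) x None) x.
Proof.
move=> hc sr xl; have [oc _] := hc; have [sc _] := oc.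
have cv := heavy_center hc; have e := light_deg hc sr.
apply: (total_low oc _ (push_total r sc) _ xl).
  by apply: good_push => //; [case: sc | move: e; clia].
by move: (potential_push t r cv) e; clia.
Qed.

Lemma total_heavy c s r v z : heavy c s v -> s != r ->
  low t (upd c v (Some r)) r z -> heavy (upd (upd c v (Some r)) z None) s z.
Proof.
move=> hc sr zl; have [e oz] := total_optimal hc sr zl; split=> //.
have [sz _] := oz; have := state_deg z sz sr.
have := sdeg_pull z (low_side zl); rewrite mult_loopless (optimal_center_simple oz).
by move: e; clia.
Qed.

Lemma low_total_side c s r v z y : s != r -> c v = None ->
  upd c v (Some r) z = Some r ->
  low t (upd (upd c v (Some r)) z None) s y = low t c s y.
Proof.
move=> sr cv cz; have rs : r != s by rewrite eq_sym.
rewrite /low (sdeg_pull_other y rs cz) (sdeg_push_other y rs cv) !updE.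
case: (y =P z) => [yz|_].
  have := cz; rewrite updE -yz; case: (y =P v) => [->|_ ->]; first by rewrite cv.
  by rewrite Some_neq.
by case: (y =P v) => [->|//]; rewrite cv Some_neq.
Qed.

(** Any low vertex [z] of the side that [v] has joined can be the centre instead,
    with heavy side [s]. *)
Lemma total_complete c s r v z y : heavy c s v -> s != r ->
  low t (upd c v (Some r)) r z -> low t c s y -> adj z y.
Proof.
move=> hc sr zl yl; have hz := total_heavy hc sr zl.
have yl' : low t (upd (upd c v (Some r)) z None) s y.
  by rewrite low_total_side //; [apply: heavy_center hc | apply: low_side zl].
by have [_] := heavy_low hz sr yl'.
Qed.

Lemma low_total c v r z : c v = None -> low t c r z ->
  sdeg c r z + mult z v < t r z -> low t (upd c v (Some r)) r z.
Proof.
move=> cv zl lt; have zv : z != v by apply: val_neq (low_side zl) cv _.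
by rewrite lowU ?(low_side zl) // sdeg_push.
Qed.

Lemma low_total_nadj c v r z : c v = None -> low t c r z -> ~~ adj z v ->
  low t (upd c v (Some r)) r z.
Proof.
move=> cv zl /mult_nadj m; apply: low_total => //; rewrite m addn0.
exact: low_lt.
Qed.

Lemma light_complete c s r v z y : heavy c s v -> s != r ->
  low t c r z -> ~~ adj z v -> low t c s y -> adj z y.
Proof.
move=> hc sr zl nzv; apply: (total_complete hc sr).
exact: low_total_nadj (heavy_center hc) zl nzv.
Qed.

Lemma total_heavy_other c s r v y : heavy c s v -> s != r -> low t c s y ->
  heavy (upd (upd c v (Some r)) y None) r y.
Proof.
move=> hc sr yl; have rs : r != s by rewrite eq_sym.
have cv := heavy_center hc; have cy := low_side yl.
have yv : y != v by apply: val_neq cy cv _.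
have yl' : low t (upd c v (Some r)) s y.
  by rewrite lowU // sdeg_push_other //; apply: low_lt.
have [_ oy] := total_optimal hc sr yl'; split=> //.
rewrite (sdeg_pull_other y sr (low_side yl')) (sdeg_push r y cv).
have [[_ m _ e] _] := simple_loose hc sr yl.
by rewrite mult_sym m (optimal_center_simple oy); move: e; clia.
Qed.

(** ** Two low vertices on the heavy side *)

(** [v y1 z0 y2] is a quadrilateral. A low vertex [z] that remains on its side
    and is adjacent neither to [v] nor to [z0] would be adjacent to [y1] and [y2],
    giving a [K23]. *)
Lemma light_nadj_pendant c s r v z0 y1 y2 : heavy c s v -> s != r ->
  low t c r z0 -> ~~ adj z0 v -> low t c s y1 -> low t c s y2 -> y1 != y2 ->
  exists2 z, low t (upd c z0 None) r z & adj z v \/ adj z z0.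
Proof.
move=> hc sr zl nzv yl1 yl2 y12; have cv := heavy_center hc.
have cz0 := low_side zl; have [[[gc _] _] _] := hc.
have [z zl'] : exists z, low t (upd c z0 None) r z.
  apply: (@low_exists_leave c r z0 z0 gc cz0); rewrite mult_loopless.
  have [e _] := total_optimal hc sr (low_total_nadj cv zl nzv).
  by move: e (t_ge2 r z0); rewrite sdeg_push // (mult_nadj nzv); clia.
have [zz0 cz] := low_leaveP (isT : None != Some r) zl'.
exists z => //; case: (boolP (adj z v)) => [|nz]; [by left | right].
apply/negPn/negP => nz0.
have zlc : low t c r z.
  by apply/negPn/negP => zN; move: nz0; rewrite (low_new cz0 _ zl' zN).
have [_ v1 _] := heavy_low hc sr yl1; have [_ v2 _] := heavy_low hc sr yl2.
have z1 := light_complete hc sr zlc nz yl1; have z2 := light_complete hc sr zlc nz yl2.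
have z01 := light_complete hc sr zl nzv yl1.
have z02 := light_complete hc sr zl nzv yl2.
have vz0 : v != z0 by rewrite eq_sym; apply: val_neq cz0 cv _.
have vz : v != z by rewrite eq_sym; apply: val_neq cz cv _.
by apply: (@two_common_nbrs _ hG y1 y2 v z0 z); symm.
Qed.

(** By the same lemma with the roles of the sides interchanged, there is a vertex
    [u] attached to [y1] or [y2] as [z] is to [v]. Moving that vertex across makes
    [u] and [z] adjacent, so two quadrilaterals share an edge. *)
Lemma light_nadj_false_center c s r v z0 y1 y2 z : heavy c s v -> s != r ->
  low t c r z0 -> ~~ adj z0 v -> low t c s y1 -> low t c s y2 -> y1 != y2 ->
  low t (upd c z0 None) r z -> adj z v -> False.
Proof.
move=> hc sr zl nzv yl1 yl2 y12 zl' zv; have cv := heavy_center hc.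
have rs : r != s by rewrite eq_sym.
have [_ v1 _] := heavy_low hc sr yl1; have [_ v2 _] := heavy_low hc sr yl2.
have z01 := light_complete hc sr zl nzv yl1.
have z02 := light_complete hc sr zl nzv yl2.
have cz0 := low_side zl; have cy1 := low_side yl1; have cy2 := low_side yl2.
have vz0 : v != z0 by rewrite eq_sym; apply: val_neq cz0 cv _.
have [zz0 cz] := low_leaveP (isT : None != Some r) zl'.
have n12 : ~~ adj y1 y2.
  apply/negP => a; move: vz0.
  by rewrite (@edge_common_nbr _ hG y1 y2 v z0) ?eqxx //; symm.
have h1 := total_heavy_other hc sr yl1.
have y1v : y1 != v by apply: val_neq cy1 cv _.
have y2v : y2 != v by apply: val_neq cy2 cv _.
have z0v : z0 != v by rewrite eq_sym.
have z0y1 : z0 != y1 by rewrite (val_neq cz0 cy1) ?Some_neq.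
have c0y1 : upd c v (Some r) y1 = Some s by rewrite upd_neq.
have [u ul uy] : exists2 u,
    low t (upd (upd (upd c v (Some r)) y1 None) y2 None) s u & adj u y1 \/ adj u y2.
  apply: (@light_nadj_pendant _ r s y1 y2 v z0) => //.
  - have y21 : y2 != y1 by rewrite eq_sym.
    rewrite lowU ?upd_neq //; move: (low_lt yl2).
    by move: (sdeg_pull y2 c0y1) (sdeg_push_other y2 rs cv); clia.
  - by rewrite adjC.
  - have vy1 : v != y1 by rewrite eq_sym.
    rewrite /low upd_neq // upd_eq eqxx /= (sdeg_pull_other v sr c0y1) (sdeg_push r v cv).
    by rewrite mult_loopless; move: (light_deg hc sr); clia.
  rewrite lowU ?upd_neq // (sdeg_pull_other z0 sr c0y1) (sdeg_push r z0 cv).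
  by rewrite (mult_nadj nzv) addn0; apply: low_lt.
have [uy2 cu''] := low_leaveP (isT : None != Some s) ul.
have uy1 : u != y1.
  by apply: contra_eq_neq cu'' => ->; rewrite upd_eq.
have cu : c u = Some s.
  move: cu''; rewrite upd_neq // updE; case: eqP => // _ [] e.
  by rewrite e eqxx in sr.
have uv : u != v by apply: val_neq cu cv _.
have uz0 : u != z0 by rewrite (val_neq cu cz0) ?Some_neq.
have ud : sdeg c s u < t s u + mult u y1 + mult u y2.
  have y21 : y2 != y1 by rewrite eq_sym.
  have c1y2 : upd (upd c v (Some r)) y1 None y2 = Some s by rewrite !upd_neq.
  move: (low_lt ul) (sdeg_pull u c1y2) (sdeg_pull u c0y1) (sdeg_push_other u rs cv); clia.
have key y y' : low t c s y -> low t c s y' -> y != y' -> adj v y -> adj v y' ->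
    adj z0 y -> adj z0 y' -> sdeg c s u < t s u + mult u y + mult u y' ->
    u != y -> u != y' -> adj u y -> False.
  move=> yl yl' yy' vy vy' z0y z0y' ud' ny ny' auy.
  have cy := low_side yl; have cy' := low_side yl'.
  have zv' : z != v by apply: val_neq cz cv _.
  have nuy' : ~~ adj u y'.
    apply/negP => uy'; apply: (@two_common_nbrs _ hG y y' v z0 u) => //; try symm.
  have nuv : ~~ adj u v.
    by apply/negP => a; apply: (@quad_no_triangle _ hG v y z0 y' u); symm.
  have nzy : ~~ adj z y.
    by apply/negP => a; apply: (@quad_no_triangle _ hG v y z0 y' z); symm.
  have neq x x' : c x = Some r -> c x' = Some s -> x != x'.
    by move=> cx cx'; rewrite (val_neq cx cx') ?Some_neq.
  have nzz0 : ~~ adj z z0.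
    apply/negP => a; have zy := neq z y cz cy; have zy' := neq z y' cz cy'.
    by apply: (@two_common_nbrs _ hG v z0 y y' z); symm.
  have [h' _] := simple_shift hc sr yl.
  have ul' : low t (upd c y (Some r)) s u.
    rewrite lowU //; move: ud' (sdeg_shift u sr cy) (mult_nadj nuy').
    by clia.
  have zl2 : low t (upd c y (Some r)) r z.
    apply: (low_shift_other sr) => //; rewrite (lowE t cz).
    by move: (low_lt zl') (sdeg_pull z cz0) (mult_nadj nzz0); clia.
  have uz := light_complete h' rs ul' nuv zl2.
  apply: (@quads_no_common_edge _ hG v y z0 y' u z); try symm.
  have nvy := adj_neq vy; have nvy' := adj_neq vy'.
  have nz0y := neq z0 y cz0 cy; have nz0y' := neq z0 y' cz0 cy'.
  have nzy' := neq z y cz cy; have nzy'' := neq z y' cz cy'.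
  have nzu := neq z u cz cu.
  by rewrite /= !inE !negb_or; repeat (apply/andP; split); symm.
case: uy => a; first exact: (key y1 y2).
by apply: (key y2 y1) => //; [rewrite eq_sym | move: ud; clia].
Qed.

(** [v] and [z] play the same part in the quadrilateral [v y1 z y2]: if the
    remaining low vertex is attached to [z], then [z] is taken as the centre. *)
Lemma light_adj_center c s r v z y1 y2 : heavy c s v -> s != r ->
  low t c r z -> low t c s y1 -> low t c s y2 -> y1 != y2 -> adj z v.
Proof.
move=> hc sr zl yl1 yl2 y12; apply/negPn/negP => nzv.
have [w wl [wv|wz]] := light_nadj_pendant hc sr zl nzv yl1 yl2 y12.
  exact: light_nadj_false_center hc sr zl nzv yl1 yl2 y12 wl wv.
have cv := heavy_center hc; have cz := low_side zl.
have zl0 := low_total_nadj cv zl nzv; have hz := total_heavy hc sr zl0.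
have [_ cw] := low_leaveP (isT : None != Some r) wl.
have zv : z != v by apply: val_neq cz cv _.
have wv : w != v by apply: val_neq cw cv _.
have vz : v != z by rewrite eq_sym.
have c0z := low_side zl0.
have cvz : upd (upd c v (Some r)) z None v = Some r by rewrite upd_neq ?upd_eq.
apply: (light_nadj_false_center hz sr (z0 := v) (z := w) _ _ (y1 := y1) (y2 := y2)) => //.
- rewrite /low cvz eqxx /=; move: (sdeg_pull v c0z) (sdeg_push r v cv) (light_deg hc sr).
  by rewrite mult_loopless; clia.
- by rewrite adjC.
- by rewrite low_total_side.
- by rewrite low_total_side.
have nwz := adj_neq wz; rewrite lowU ?upd_neq //.
move: (low_lt wl) (sdeg_pull w cz) (sdeg_pull w c0z) (sdeg_push r w cv) (sdeg_pull w cvz).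
by clia.
Qed.

(** If [y] and [y'] are adjacent, then after moving [y] across and adding [v] to
    the side of [y'], the vertex [y'] is still low, hence adjacent to [z]. *)
Lemma heavy_indep c s r v z y y' : heavy c s v -> s != r ->
  low t c r z -> adj z v -> low t c s y -> low t c s y' -> ~~ adj y y'.
Proof.
move=> hc sr zl zv yl yl'; apply/negP => yy'; have rs : r != s by rewrite eq_sym.
have [_ vy _] := heavy_low hc sr yl; have [_ vy' _] := heavy_low hc sr yl'.
have cz := low_side zl; have cy := low_side yl; have cy' := low_side yl'.
have zy' : z != y' by rewrite (val_neq cz cy') ?Some_neq.
have zy : z != y by rewrite (val_neq cz cy) ?Some_neq.
have nzy : ~~ adj z y.
  apply/negP => a; move: zy'.
  by rewrite (@edge_common_nbr _ hG v y z y') ?eqxx //; symm.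
have nzy' : ~~ adj y' z.
  apply/negP => a; move: zy.
  by rewrite (@edge_common_nbr _ hG v y' z y) ?eqxx //; symm.
have [h' _] := simple_shift hc sr yl.
have zl' := low_shift_other sr cy cz zl nzy.
have y'y : y' != y by rewrite eq_sym adj_neq.
have y'l' : low t (upd c y (Some r)) s y'.
  by apply: low_stays => //; rewrite Some_neq.
move: nzy'; rewrite (@total_complete _ r s v y' z h' rs) //.
apply: (low_total (heavy_center h') y'l').
move: (low_lt yl') (sdeg_shift y' sr cy) yy'; rewrite [mult y' v]mult_sym (heavy_mult hc vy').
by rewrite adjC /adj; clia.
Qed.

(** Since [y] and [z] are not adjacent, [z] stays low when [y] arrives. *)
Lemma exchange c s r v y z : heavy c s v -> s != r -> low t c s y ->
  low t c r z -> ~~ adj y z ->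
  let c' := upd (upd c y (Some r)) z (Some s) in
  [/\ heavy c' s v, low t c' s z, low t c' r y &
      forall x, sdeg c' r x + mult x z = sdeg c r x + mult x y].
Proof.
move=> hc sr yl zl nyz /=; have rs : r != s by rewrite eq_sym.
have [h1 yl1] := simple_shift hc sr yl; have cy := low_side yl; have cz := low_side zl.
have nzy : ~~ adj z y by rewrite adjC.
have zl1 := low_shift_other sr cy cz zl nzy.
have [h2 zl2] := simple_shift h1 rs zl1.
have yz : y != z by rewrite (val_neq cy cz) ?Some_neq.
split=> //; first by apply: (low_stays (low_side zl1)); rewrite ?Some_neq.
move=> x; rewrite (sdeg_shift x rs (low_side zl1)); exact: sdeg_shift_other x sr cy.
Qed.

(** When [y] has moved, [y] and [z] are two low vertices on the new heavy side. *)
Lemma leave_adj_center c s r v z y u : heavy c s v -> s != r ->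
  low t c s y -> low t c r z -> ~~ adj y z ->
  low t (upd c y (Some r)) s u -> adj v u.
Proof.
move=> hc sr yl zl nyz ul; have rs : r != s by rewrite eq_sym.
have [h1 yl1] := simple_shift hc sr yl; have cy := low_side yl; have cz := low_side zl.
have nzy : ~~ adj z y by rewrite adjC.
have zl1 := low_shift_other sr cy cz zl nzy.
rewrite adjC; apply: (light_adj_center h1 rs ul yl1 zl1).
by rewrite (val_neq cy cz) ?Some_neq.
Qed.

(** When also [y'] has moved, [y'] and [x] are two low vertices on the new heavy
    side. *)
Lemma exchange_leave_adj_center c s r v z y y' x u : heavy c s v -> s != r ->
  low t c s y -> low t c r z -> ~~ adj y z ->
  low t (upd c y (Some r)) s y' -> ~~ adj y' z ->
  low t (upd (upd c y (Some r)) z (Some s)) r x -> ~~ adj x y' ->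
  low t (upd (upd (upd c y (Some r)) z (Some s)) y' (Some r)) s u -> adj v u.
Proof.
move=> hc sr yl zl nyz y'l ny'z xl nxy' ul; have rs : r != s by rewrite eq_sym.
have [h2 _ _ _] := exchange hc sr yl zl nyz.
have nzy : ~~ adj z y by rewrite adjC.
have zl1 := low_shift_other sr (low_side yl) (low_side zl) zl nzy.
have y'l2 := low_shift_other rs (low_side zl1) (low_side y'l) y'l ny'z.
have [h3 y'l3] := simple_shift h2 sr y'l2.
have xl3 := low_shift_other sr (low_side y'l2) (low_side xl) xl nxy'.
rewrite adjC; apply: (light_adj_center h3 rs ul y'l3 xl3).
by rewrite (val_neq (low_side y'l2) (low_side xl)) ?Some_neq.
Qed.

(** The pool of the heavy side can be exhausted against [z1]: in every state on
    the way, the vertex that has just moved is low on its new side, together with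
    [z2] or with the vertex that moved before it. *)
Lemma two_low_each_false c s r v y1 y2 z1 z2 : heavy c s v -> s != r ->
  low t c s y1 -> low t c s y2 -> y1 != y2 ->
  low t c r z1 -> low t c r z2 -> z1 != z2 -> False.
Proof.
move=> hc sr yl1 yl2 y12 zl1 zl2 z12; have rs : r != s by rewrite eq_sym.
have zv z : low t c r z -> adj z v.
  by move=> zl; apply: light_adj_center hc sr zl yl1 yl2 y12.
have indep y y' : low t c s y -> low t c s y' -> ~~ adj y y'.
  exact: heavy_indep hc sr zl1 (zv _ zl1).
have vy y : low t c s y -> adj v y by move=> yl; have [] := heavy_low hc sr yl.
have neq x x' : c x = Some r -> c x' = Some s -> x != x'.
  by move=> cx cx'; rewrite (val_neq cx cx') ?Some_neq.
have cz1 := low_side zl1; have cz2 := low_side zl2.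
have nz12 : ~~ adj z1 z2.
  apply/negP => zz.
  have nzy z z' y : low t c r z -> low t c r z' -> adj z z' -> low t c s y ->
      ~~ adj y z.
    move=> zl zl' a yl; apply/negP => yz.
    have := neq z' y (low_side zl') (low_side yl).
    have vz := zv z zl; have vz' := zv z' zl'; have vy' := vy y yl.
    by rewrite (@edge_common_nbr _ hG v z z' y) ?eqxx //; symm.
  have zz' : adj z2 z1 by rewrite adjC.
  have ny1z1 := nzy z1 z2 y1 zl1 zl2 zz yl1.
  have [h2 _ _ dr] := exchange hc sr yl1 zl1 ny1z1.
  have z21 : z2 != z1 by rewrite eq_sym.
  have y21 : y2 != y1 by rewrite eq_sym.
  have y2l1 : low t (upd c y1 (Some r)) s y2.
    by apply: low_stays; rewrite ?(low_side yl1) ?Some_neq.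
  have cz1' : upd c y1 (Some r) z1 = Some r by rewrite upd_neq ?neq ?(low_side yl1).
  have y2l2 := low_shift_other rs cz1' (low_side y2l1) y2l1 (nzy z1 z2 y2 zl1 zl2 zz yl2).
  have := nzy z2 z1 y2 zl2 zl1 zz' yl2; rewrite adjC.
  rewrite (@total_complete _ s r v z2 y2 h2 sr) //.
  have m2v : mult z2 v = 1 by rewrite mult_sym (heavy_mult hc) // adjC zv.
  have nz2y1 : ~~ adj z2 y1 by rewrite adjC (nzy z2 z1).
  have e := dr z2; have lt := low_lt zl2.
  have dz : sdeg (upd (upd c y1 (Some r)) z1 (Some s)) r z2 + 1 <= sdeg c r z2.
    by move: e zz (mult_nadj nz2y1); rewrite adjC /adj; clia.
  have c2z2 : upd (upd c y1 (Some r)) z1 (Some s) z2 = Some r.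
    by rewrite !upd_neq // neq // (low_side yl1).
  apply: (low_total (heavy_center h2)); first by rewrite (lowE t c2z2); move: dz lt; clia.
  by rewrite m2v; move: dz lt; clia.
have vz1 : adj v z1 by rewrite adjC zv.
have vz2 : adj v z2 by rewrite adjC zv.
have [[sc _] _] := hc.
have leave_adj y u : low t c s y -> low t (upd c y (Some r)) s u -> adj v u.
  move=> yl; have [a|] := boolP (adj y z1); last exact: leave_adj_center hc sr yl zl1.
  apply: (leave_adj_center hc sr yl zl2); apply/negP => a'; move: z12.
  by have vy0 := vy y yl; rewrite (@edge_common_nbr _ hG v y z1 z2) ?eqxx //; symm.
apply: (state_pool_false sc sr cz1 vz1 (heavy_has_low hc) _ indep leave_adj).
- move=> y yl; have [[mx m1 e _] _] := simple_loose hc sr yl.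
  by split=> //; apply: vy.
move=> y y' u yl nyz y'l ny'z ul uz.
have [_ _ yl' dr] := exchange hc sr yl zl1 nyz.
have [yy'|nyy'] := boolP (adj y y'); last exact: exchange_leave_adj_center nyy' ul.
have vy' := leave_adj y y' yl y'l.
have rsN : Some r != Some s by rewrite Some_neq.
have [_ cy'] := low_leaveP rsN y'l.
have nz2y : ~~ adj z2 y.
  apply/negP => a; have := neq z2 y' cz2 cy'.
  by have vy0 := vy y yl; rewrite (@edge_common_nbr _ hG v y z2 y') ?eqxx //; symm.
have nz2y' : ~~ adj z2 y'.
  apply/negP => a; have := neq z2 y cz2 (low_side yl).
  by have vy0 := vy y yl; rewrite (@edge_common_nbr _ hG v y' z2 y) ?eqxx //; symm.
have z21 : z2 != z1 by rewrite eq_sym.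
apply: (exchange_leave_adj_center hc sr yl zl1 nyz y'l ny'z _ nz2y' ul).
have c2z2 : upd (upd c y (Some r)) z1 (Some s) z2 = Some r.
  by rewrite !upd_neq // neq // (low_side yl).
rewrite (lowE t c2z2); move: (dr z2) (mult_nadj nz2y) (low_lt zl2).
by clia.
Qed.

(** ** Triangles around a simple centre *)

Lemma simple_tri_shift c s r v z y p : tri c s r v z y p ->
  tri (upd c p (Some r)) r s v y z p.
Proof.
move=> T; have [sr hc [_ pl _] _ _] := T; have [_ _ yv _ _] := tri_adj T.
apply: tri_shift T _ _; first by have [] := simple_loose hc sr pl.
by rewrite (heavy_mult hc) ?(heavy_simple hc) // adjC.
Qed.

Lemma simple_tri_only c s r v z y p x : tri c s r v z y p ->
  low t (upd c p None) s x -> x = z.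
Proof.
move=> T xl; have [sr hc [_ pl _] yl _] := T.
have [rs h2 [yl2 pl2 py] zl2 _] := simple_tri_shift T.
apply/eqP/negPn/negP => xz; apply: (two_low_each_false h2 rs yl2 pl2 _ zl2 (z2 := x)).
- by rewrite eq_sym.
- by rewrite low_leave // Some_neq // eq_sym.
by rewrite eq_sym.
Qed.

Lemma simple_tri_false c s r v z y p : ~ tri c s r v z y p.
Proof.
apply: (triangle_false hG t_ge2) => {c s r v z y p}.
- by move=> c s r v z y p T; apply: tri_good T.
- by move=> c s r v z y p T; apply: tri_sides T.
- by move=> c s r v z y p T; apply: tri_adj T.
- by move=> c s r v z y p [_ _ _ _ []].
- by move=> c s r v z y p x; apply: simple_tri_only.
- by move=> c s r v z y p; apply: simple_tri_shift.
- move=> c s r v z y p T; apply: (tri_pendant T) => x; exact: simple_tri_only T.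
move=> c s r v z y p w T wz wl; have [vl wl' yl wv] := tri_amove_low T wz wl.
have [sr hc [zl _ _] _ _] := T; have [[mz _ _ _] hz] := simple_loose hc sr zl.
have [vz _ _ _ _] := tri_adj T.
apply: (tri_amove T wz wl _ hz); first by have [[]] := simple_loose hz sr wl'.
by rewrite mult_sym (heavy_mult hc) // mz.
Qed.

(** If [y] is the only low vertex of the heavy side, then moving it across, taking
    it as the centre, or completing the state before doing so gives a second low
    vertex, unless [v], [y] and the low vertices [z] and [u] form a [K4_minus]. *)
Lemma two_low_exist c s v : heavy c s v -> exists c' s' v' y1 y2,
  [/\ heavy c' s' v', low t c' s' y1, low t c' s' y2 & y1 != y2].
Proof.
move=> hc; pose r := ~~ s; have sr : s != r by rewrite /r; case: (s).
have rs : r != s by rewrite eq_sym.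
have cv := heavy_center hc; have [[[gc _] _] _] := hc.
have [y yl] := heavy_has_low hc; have cy := low_side yl.
have [_ vy _] := heavy_low hc sr yl; have [[_ _ ey _] hy] := simple_loose hc sr yl.
have [p /andP[pl py]|none] := pickP (fun p => low t c s p && (p != y)).
  by exists c, s, v, p, y.
have only p : low t c s p -> p = y.
  by move=> pl; apply/eqP; move: (none p); rewrite pl; case: eqP.
have [z zl] : exists z, low t c r z.
  apply: (@side_has_low _ _ v) => //.
  by move: (light_deg hc sr) (t_ge2 r v); clia.
have cz := low_side zl.
have [h1 yl1] := simple_shift hc sr yl.
have [zy|nzy] := boolP (adj z y); last first.
  exists (upd c y (Some r)), r, v, y, z; split=> //.
    exact: (low_shift_other sr cy cz zl nzy).
  by rewrite (val_neq cy cz) ?Some_neq.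
have [u ul] : exists u, low t (upd c y None) s u.
  apply: (@low_exists_leave c s y y gc cy).
  by rewrite mult_loopless; move: ey (t_ge2 s y); clia.
have [uy cu] := low_leaveP (isT : None != Some s) ul.
have auy : adj u y.
  by apply: (low_new cy _ ul) => //; apply: contraNN uy => /only ->.
have uv : u != v by apply: val_neq cu cv _.
have zv : z != v by apply: val_neq cz cv _.
have [auv|nuv] := boolP (adj u v); last first.
  exists (amove c v s y), s, y, v, u; split=> //; last by rewrite eq_sym.
    by apply: amove_low_center => //; rewrite (heavy_mult hc vy) (heavy_simple hc).
  exact: amove_low_leave.
have [azv|nzv] := boolP (adj z v).
  have := val_neq cz cu; rewrite Some_neq // => /(_ isT).
  by rewrite (@edge_common_nbr _ hG v y z u) ?eqxx //; symm.
have yv : y != v by rewrite eq_sym adj_neq.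
have vy' : v != y by rewrite eq_sym.
have zy' : z != y by rewrite adj_neq.
have c0y : upd c v (Some r) y = Some s by rewrite upd_neq.
exists (upd (upd c v (Some r)) y None), r, y, v, z; split.
- exact: total_heavy_other hc sr yl.
- rewrite /low upd_neq // upd_eq eqxx /= (sdeg_pull_other v sr c0y) (sdeg_push r v cv).
  by rewrite mult_loopless; move: (light_deg hc sr); clia.
- rewrite lowU ?upd_neq // (sdeg_pull_other z sr c0y) (sdeg_push r z cv).
  by rewrite (mult_nadj nzv) addn0; apply: low_lt.
by rewrite eq_sym.
Qed.

(** By the preceding results there are two low vertices on the heavy side, and the
    low vertex [z] of the light side makes no triangle with [v] and one of them.
    This allows one to exhaust the pool against [z], except that the exchange may
    create a triangle [v y' y] with [z] as pendant. *)
Lemma no_optimal_state c v : ~ optimal t c v.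
Proof.
move=> /heavy_exists[{}c [s /two_low_exist[{}c [{}s [{}v [y1 [y2 [hc yl1 yl2 y12]]]]]]]].
pose r := ~~ s; have sr : s != r by rewrite /r; case: (s).
have rs : r != s by rewrite eq_sym.
have [[sc _] _] := hc; have [gc _] := sc; have mv := heavy_simple hc.
have [z zl] : exists z, low t c r z.
  apply: (@side_has_low _ _ v) => //.
  by move: (light_deg hc sr) (t_ge2 r v); clia.
have zv := light_adj_center hc sr zl yl1 yl2 y12.
have vz : adj v z by rewrite adjC.
have cz := low_side zl.
have vy y : low t c s y -> adj v y by move=> yl; have [] := heavy_low hc sr yl.
have nyz y : low t c s y -> ~~ adj y z.
  move=> yl; apply/negP => yz.
  have [p pl py] : exists2 p, low t c s p & p != y.
    have [<-|n] := eqVneq y1 y; [exists y2 | exists y1] => //.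
    by rewrite eq_sym.
  have [[mp _ _ _] _] := simple_loose hc sr pl.
  apply: (@simple_tri_false c s r v y z p); split=> //; split=> //; first exact: vy.
  by rewrite (heavy_mult hc) ?mv //; apply: vy.
have leave_adj y u : low t c s y -> low t (upd c y (Some r)) s u -> adj v u.
  by move=> yl; apply: leave_adj_center hc sr yl zl (nyz y yl).
apply: (state_pool_false sc sr cz vz (heavy_has_low hc) _ _ leave_adj).
- move=> y yl; have [[mx m1 e _] _] := simple_loose hc sr yl.
  by split=> //; apply: vy.
- by move=> y y' yl yl'; apply: (heavy_indep hc sr zl zv yl yl').
move=> y y' u yl yz y'l ny'z ul uz.
have [h2 zl2 yl2' _] := exchange hc sr yl zl yz.
have [yy'|nyy'] := boolP (adj y y'); last exact: exchange_leave_adj_center nyy' ul.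
exfalso; have vy' := leave_adj y y' yl y'l.
have nzy : ~~ adj z y by rewrite adjC.
have zl1 := low_shift_other sr (low_side yl) cz zl nzy.
have y'l2 := low_shift_other rs (low_side zl1) (low_side y'l) y'l ny'z.
have [[mz _ _ _] _] := simple_loose h2 sr zl2.
have zy' : z != y' by rewrite (val_neq (low_side zl1) (low_side y'l)) ?Some_neq.
have yv : adj y v by rewrite adjC vy.
apply: (@simple_tri_false _ s r v y' y z); split=> //; first exact: h2; first by split.
  exact: yl2'.
by split=> //; [rewrite adjC | rewrite (heavy_mult hc) ?mv].
Qed.

End Critical.

(** * From feasible pairs to feasible partitions *)

(** Take [X] as large as possible. Any vertex outside [X] and [Y] then has fewer
    than [a y] neighbours in [X], hence at least [b y] outside. *)
Lemma feasible_pair_extend (G : multigraph) (a b : G -> nat) (X Y : {set G}) :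
  (forall x, a x + b x <= deg x + 1) -> X != set0 -> Y != set0 ->
  [disjoint X & Y] -> feasible a b X Y ->
  exists X' Y' : {set G}, is_bipartition X' Y' /\ feasible a b X' Y'.
Proof.
move=> hab X0 Y0 dXY [fX fY].
pose nice (Z : {set G}) :=
  [&& Z != set0, [disjoint Z & Y] & [forall x in Z, a x <= deg_in Z x]].
have nX : nice X by rewrite /nice X0 dXY; apply/forall_inP.
case: (arg_maxnP (fun Z : {set G} => #|Z|) nX) => Z /and3P[Z0 dZY /forall_inP fZ] maxZ.
have YZ : Y \subset ~: Z by rewrite -disjoints_subset disjoint_sym.
exists Z, (~: Z); split; first split=> //.
- by apply: contraNneq Y0 => e; rewrite -subset0 -e.
- by rewrite -setI_eq0 setICr.
- by rewrite setUCr.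
split=> // y; rewrite inE => yZ.
have [yY|yY] := boolP (y \in Y).
  exact: leq_trans (fY y yY) (deg_in_sub _ YZ).
have lt : deg_in Z y < a y.
  rewrite ltnNge; apply/negP => le; have : nice (y |: Z); last first.
    by move/maxZ; rewrite cardsU1 yZ; clia.
  apply/and3P; split; first by apply/set0Pn; exists y; rewrite setU11.
    by rewrite -setI_eq0 setIUl setU_eq0 !setI_eq0 disjoints1 yY.
  apply/forall_inP => x; rewrite !inE => /predU1P[->|xZ].
    by rewrite deg_in_add // mult_loopless.
  exact: leq_trans (fZ x xZ) (deg_in_sub _ (subsetUr _ _)).
have := hab y; rewrite /deg (@deg_in_split _ _ Z) ?subsetT // setTD.
by move: lt; clia.
Qed.

(** All proper subsets of a smallest feasible set [M] are meager, and so is its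
    complement. *)
Lemma initial_state (G : multigraph) (t : bool -> G -> nat) :
  (forall x, t true x <= deg x) ->
  (forall X Y : {set G}, [disjoint X & Y] -> meager t true X || meager t false Y) ->
  exists c v, is_state t c v.
Proof.
move=> t_deg one.
pose nice (Z : {set G}) := (Z != set0) && [forall x in Z, t true x <= deg_in Z x].
have nT : nice [set: G].
  apply/andP; split; last by apply/forall_inP => x _; apply: t_deg.
  by have /card_gt0P[x _] := vertex_nonempty G; apply/set0Pn; exists x.
case: (arg_minnP (fun Z : {set G} => #|Z|) nT) => M /andP[/set0Pn[v vM] /forall_inP fM] minM.
exists [ffun x => if x == v then None else Some (x \in M)], v; split; last first.
  by move=> x; rewrite ffunE; case: (x == v).
case.
  have -> : side [ffun x => if x == v then None else Some (x \in M)] true = M :\ v.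
    by apply/setP => x; rewrite !inE ffunE; case: (x == v); case: (x \in M).
  apply/negPn/negP => /not_meager[Z [ZM Z0 fZ]].
  have /minM : nice Z by rewrite /nice Z0; apply/forall_inP.
  by move: (subset_leq_card ZM); rewrite (cardsD1 v M) vM; clia.
have -> : side [ffun x => if x == v then None else Some (x \in M)] false = ~: M.
  apply/setP => x; rewrite !inE ffunE; case: (x =P v) => [->|_]; first by rewrite vM.
  by case: (x \in M).
have /orP[mM|//] : meager t true M || meager t false (~: M).
  by apply: one; rewrite -setI_eq0 setICr.
have [|x xM] := meager_low mM; first by apply/set0Pn; exists v.
by rewrite ltnNge fM.
Qed.

(* The truncated subtraction is exact, since a x + b x >= 4. *)
Theorem theorem1p5 (G : multigraph) (hG : quadrilaterals_isolated G)
    (a b : G -> nat)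
    (ha : forall x : G, 2 <= a x) (hb : forall x : G, 2 <= b x)
    (hdeg : forall x : G, a x + b x + 2 * max_mult x - 3 <= deg x) :
  exists X Y : {set G}, is_bipartition X Y /\ feasible a b X Y.
Proof.
pose a' x := deg x + 3 - b x - 2 * max_mult x.
pose t (s : bool) := if s then a' else b.
have aa' x : a x <= a' x by move: (hdeg x); rewrite /a'; clia.
have t_ge2 s x : 2 <= t s x by case: s => //=; apply: leq_trans (aa' x).
have tight x : deg x + 3 = t true x + t false x + 2 * max_mult x.
  by move: (hdeg x) (ha x); rewrite /= /a'; clia.
have m0 := max_mult_gt0 t_ge2 tight.
have [one|] := boolP [forall X : {set G}, forall Y : {set G},
    [disjoint X & Y] ==> meager t true X || meager t false Y].
  have one_meager (X Y : {set G}) :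
      [disjoint X & Y] -> meager t true X || meager t false Y.
    by move: one => /forallP/(_ X)/forallP/(_ Y)/implyP.
  have [|c [v sc]] := initial_state _ one_meager.
    by move=> x; move: (tight x) (m0 x) (t_ge2 false x); clia.
  have [c' [v' oc]] := optimal_exists sc.
  by case: (no_optimal_state hG t_ge2 tight one_meager oc).
rewrite negb_forall => /existsP[X0]; rewrite negb_forall => /existsP[Y0].
rewrite negb_imply negb_or => /and3P[dXY /not_meager[X [XX0 Xn fX]] /not_meager[Y [YY0 Yn fY]]].
apply: (feasible_pair_extend _ Xn Yn).
- by move=> x; move: (hdeg x) (m0 x); clia.
- exact: disjointWl XX0 (disjointWr YY0 dXY).
split=> x xZ; last exact: fY.
exact: leq_trans (aa' x) (fX x xZ).
Qed.
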